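(* Let $E\to M$ be a nonzero vector bundle, let $L\subset\mathcal{E}=\mathfrak{D}E\oplus\mathfrak{J}E$ be a Dirac structure in the omni-Lie algebroid of $E$, and for $X\in\Gamma(\mathcal{E})$ let $\omega_X=(X,\cdot)_E: L\to E$, regarded as a $1$-cochain in $\Gamma(\mathrm{Hom}(L,E))$. Then $X\in N_L$ if and only if $d_L\omega_X=0$.
   Context: Omni-Lie algebroid. $\mathfrak{D}E$ is the gauge Lie algebroid of $E$: its sections are the $\mathbb{R}$-linear operators $\mathfrak{d}:\Gamma(E)\to\Gamma(E)$ for which there is a vector field $\alpha(\mathfrak{d})$ with $\mathfrak{d}(fu)=f\mathfrak{d}u+\alpha(\mathfrak{d})(f)u$; the bracket $[\cdot,\cdot]_{\mathfrak{D}}$ is the commutator and the anchor is $\alpha:\mathfrak{D}E\to TM$. $\mathfrak{J}E$ is the first jet bundle of $E$ with projection $\mathbf{p}:\mathfrak{J}E\to E$ and $\ker\mathbf{p}=\mathrm{Hom}(TM,E)$. For $u\in\Gamma(E)$, $\mathbf{d}u\in\Gamma(\mathfrak{J}E)$ denotes its first jet; $\mathrm{Hom}(TM,E)$ is embedded so that $\mathbf{d}(fu)=f\,\mathbf{d}u+df\otimes u$. There is a nondegenerate $C^\infty(M)$-bilinear $E$-valued pairing with $\langle\mathbf{d}u,\mathfrak{d}\rangle_E=\langle\mathfrak{d},\mathbf{d}u\rangle_E=\mathfrak{d}u$. For $\mathfrak{d}\in\Gamma(\mathfrak{D}E)$ and $\mu\in\Gamma(\mathfrak{J}E)$, the Lie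 derivative $\mathfrak{L}_{\mathfrak{d}}\mu\in\Gamma(\mathfrak{J}E)$ is defined by $\langle\mathfrak{L}_{\mathfrak{d}}\mu,\mathfrak{d}'\rangle_E=\mathfrak{d}\langle\mu,\mathfrak{d}'\rangle_E-\langle\mu,[\mathfrak{d},\mathfrak{d}']_{\mathfrak{D}}\rangle_E$. On $\mathcal{E}=\mathfrak{D}E\oplus\mathfrak{J}E$ let $\rho:\mathcal{E}\to\mathfrak{D}E$ be the projection, $$\{\mathfrak{d}+\mu,\mathfrak{r}+\nu\}=[\mathfrak{d},\mathfrak{r}]_{\mathfrak{D}}+\mathfrak{L}_{\mathfrak{d}}\nu-\mathfrak{L}_{\mathfrak{r}}\mu+\mathbf{d}\langle\mu,\mathfrak{r}\rangle_E,\qquad (\mathfrak{d}+\mu,\mathfrak{r}+\nu)_E=\tfrac12(\langle\mathfrak{d},\nu\rangle_E+\langle\mathfrak{r},\mu\rangle_E).$$ For a subbundle $S\subset\mathcal{E}$, $S^\perp=\{X\in\mathcal{E}: (X,s)_E=0\ \forall s\in S\}$. A Dirac structure is a subbundle $L$ that is maximal isotropic (equivalently $L=L^\perp$) with $\{\Gamma(L),\Gamma(L)\}\subset\Gamma(L)$; it is a Lie algebroid with the restricted bracket and anchor $\alpha\circ\rho$, and $\rho_L=\rho|_L:L\to\mathfrak{D}E$ is a representation of $L$ on $E$. $d_L:\Gamma(\mathrm{Hom}(\wedge^\bullet L,E))\to\Gamma(\mathrm{Hom}(\wedge^{\bullet+1}L,E))$ is the Lie algebroid coboundary operator of this representation;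 on $1$-cochains $d_L\omega(l_1,l_2)=\rho_L(l_1)\omega(l_2)-\rho_L(l_2)\omega(l_1)-\omega(\{l_1,l_2\})$. The normalizer of a subbundle $C\subset\mathcal{E}$ is $N_C=\{X\in\Gamma(\mathcal{E}): \{X,Y\}\in\Gamma(C)\ \forall\, Y\in\Gamma(C)\}$. *)

(* Defs.v *)
From HB Require Import structures.
From mathcomp Require Import all_boot all_order all_algebra.
From mathcomp Require Import all_classical all_reals all_analysis.

Set Implicit Arguments.
Unset Strict Implicit.
Unset Printing Implicit Defensive.

Import Order.TTheory GRing.Theory Num.Theory.
Import numFieldNormedType.Exports.

Local Open Scope classical_set_scope.
Local Open Scope ring_scope.

Section Ck.
Context {R : realType} {V : normedModType R}.
Implicit Types (U : set V) (f g : V -> R) (k : nat).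

Fixpoint Ck k U f : Prop :=
  if k is k'.+1 then
    (forall x, U x -> differentiable f x) /\
    (forall v, Ck k' U (fun x => 'd f x v))
  else forall x, U x -> {for x, continuous f}.

Definition Cinfty U f := forall k, Ck k U f.

Lemma near0_diff (h : V -> R) (x : V) : (\near x, h x = 0) ->
  differentiable h x /\ 'd h x = 0 :> (V -> R).
Proof.
move=> h0; have hx : h x = 0 by exact: nbhs_singleton h0.
have hE : h \o shift x = cst (h x) + (\0 : V -> R) +o_ 0 id.
  apply/eqaddoP => _/posnumP[e].
  have h0' : \forall y \near 0, h (y + x) = 0.
    by move: h0; rewrite (near_shift 0) subr0.
  near=> y; rewrite /= !fctE /= hx (near h0' y) //.
  by rewrite !addr0 subr0 normr0 mulr_ge0.
have d0 : 'd h x = \0 :> (V -> R).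
  by apply: diff_unique => // y; exact: cvg_cst.
split => //; apply/diff_locallyP; rewrite d0; split => // y; exact: cvg_cst.
Unshelve. all: by end_near. Qed.

Lemma near_eq_diff f g (x : V) : (\near x, f x = g x) -> differentiable f x ->
  differentiable g x /\ 'd g x = 'd f x :> (V -> R).
Proof.
move=> fg df; have [] := @near0_diff (g - f) x.
  by apply: filterS fg => y /= fgy; rewrite !fctE fgy subrr.
move=> dh dh0; have -> : g = f + (g - f) by rewrite addrC subrK.
split; first exact: differentiableD.
  by rewrite diffD //; apply/funext => v /=; rewrite dh0 /= addr0.
Qed.

Lemma Ck_ext k U f g : open U -> (forall x, U x -> f x = g x) ->
  Ck k U f -> Ck k U g.
Proof.
move=> Uo; elim: k f g => [|k IH] f g fg /=.
  move=> fc x Ux; rewrite /prop_for /continuous_at -fg//.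
  apply: cvg_trans (fc x Ux); apply: near_eq_cvg.
  by near=> y; rewrite -fg//; near: y; exact: open_nbhs_nbhs.
have fgx x : U x -> \near x, f x = g x.
  by move=> Ux; near=> y; rewrite -fg//; near: y; exact: open_nbhs_nbhs.
move=> [df dfk]; split=> [x Ux|v].
  by have [] := near_eq_diff (fgx x Ux) (df x Ux).
apply: IH (dfk v) => x Ux.
by have [_ ->] := near_eq_diff (fgx x Ux) (df x Ux).
Unshelve. all: by end_near. Qed.

Lemma CkS k U f : Ck k.+1 U f -> Ck k U f.
Proof.
elim: k f => [|k IH] f [df dfk].
  by move=> x Ux; exact/differentiable_continuous/df.
by split=> // v; exact/IH/dfk.
Qed.

Lemma Ck_cst k U c : Ck k U (cst c).
Proof.
elim: k c => [|k IH] c /=; first by move=> x _; exact: cvg_cst.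
split=> [x _|v]; first exact: differentiable_cst.
have -> : (fun x : V => 'd (cst c) x v) = cst 0.
  by apply/funext => x; rewrite diff_cst.
exact: IH.
Qed.

Lemma CkD k U f g : open U -> Ck k U f -> Ck k U g -> Ck k U (f \+ g).
Proof.
move=> Uo; elim: k f g => [|k IH] f g /=.
  by move=> fc gc x Ux; apply: continuousD; [exact: fc | exact: gc].
move=> [df dfk] [dg dgk]; split=> [x Ux|v].
  by apply: differentiableD; [exact: df | exact: dg].
apply: Ck_ext (IH _ _ (dfk v) (dgk v)) => // x Ux.
by rewrite diffD; [|exact: df|exact: dg].
Qed.

Lemma CkM k U f g : open U -> Ck k U f -> Ck k U g -> Ck k U (f \* g).
Proof.
move=> Uo; elim: k f g => [|k IH] f g.
  by move=> fc gc x Ux; apply: continuousM; [exact: fc | exact: gc].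
move=> fk gk; have [df dfk] := fk; have [dg dgk] := gk; split=> [x Ux|v].
  by apply: differentiableM; [exact: df | exact: dg].
have dfg := CkD Uo (IH _ _ (CkS fk) (dgk v)) (IH _ _ (CkS gk) (dfk v)).
apply: Ck_ext dfg => //.
by move=> x Ux; rewrite /= diffM; [|exact: df|exact: dg].
Qed.

Lemma Ck_sub k U W f : U `<=` W -> Ck k W f -> Ck k U f.
Proof.
move=> UW; elim: k f => [|k IH] f; first by move=> fc x /UW; exact: fc.
by move=> [df dfk]; split=> [x /UW|v]; [exact: df | exact/IH/dfk].
Qed.

End Ck.

(* [cmap i] and [cinv i] are total functions, mutually inverse between [cdom i]
   and its open image; their values elsewhere are irrelevant. *)
Record manifold (R : realType) := Manifold {
  mpoint :> topologicalType;
  mdim : nat;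
  mhausdorff : hausdorff_space mpoint;
  mcountable : @second_countable mpoint;
  chart : Type;
  cdom : chart -> set mpoint;
  cmap : chart -> mpoint -> 'rV[R]_mdim;
  cinv : chart -> 'rV[R]_mdim -> mpoint;
  cdom_open : forall i, open (cdom i);
  cdom_cover : forall x, exists i, cdom i x;
  cimg_open : forall i, open (cmap i @` cdom i);
  cmapK : forall i x, cdom i x -> cinv i (cmap i x) = x;
  cmap_continuous : forall i x, cdom i x -> {for x, continuous (cmap i)};
  cinv_continuous : forall i z, (cmap i @` cdom i) z ->
    {for z, continuous (cinv i)};
  ctrans_smooth : forall i j k, Cinfty (cmap i @` (cdom i `&` cdom j))
    (fun z => cmap j (cinv i z) 0 k) }.

Section Manifold.
Context {R : realType} {M : manifold R}.

Lemma cimgI_open (i : chart M) (U : set M) : open U ->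
  open (cmap i @` (cdom i `&` U)).
Proof.
move=> Uo; rewrite openE => _ [x [xi Ux] <-].
have zi : (cmap i @` cdom i) (cmap i x) by exists x.
have Uz : nbhs (cinv i (cmap i x)) U.
  by rewrite cmapK//; exact: open_nbhs_nbhs.
have h1 : nbhs (cmap i x) (cinv i @^-1` U).
  exact: (@cinv_continuous R M i _ zi U Uz).
have h2 : nbhs (cmap i x) (cmap i @` cdom i).
  by apply: open_nbhs_nbhs; split => //; exact: cimg_open.
apply: filterS2 h1 h2 => z Uinv [y yi yz]; exists y => //; split => //.
by move: Uinv; rewrite /= -yz cmapK.
Qed.

(* Meaningful for U open. *)
Definition smooth_on (U : set M) (f : M -> R) :=
  forall i : chart M, Cinfty (cmap i @` (cdom i `&` U)) (f \o cinv i).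

Lemma smooth_onD U f g : open U ->
  smooth_on U f -> smooth_on U g -> smooth_on U (f \+ g).
Proof.
move=> Uo fs gs i k.
by apply: CkD; [exact: cimgI_open|exact: fs|exact: gs].
Qed.

Lemma smooth_onM U f g : open U ->
  smooth_on U f -> smooth_on U g -> smooth_on U (f \* g).
Proof.
move=> Uo fs gs i k.
by apply: CkM; [exact: cimgI_open|exact: fs|exact: gs].
Qed.

Lemma smooth_on_cst U c : smooth_on U (cst c).
Proof. by move=> i k; exact: Ck_cst. Qed.

Lemma smooth_on_sub U W f : open U -> U `<=` W ->
  smooth_on W f -> smooth_on U f.
Proof.
move=> _ UW fs i k; apply: Ck_sub (fs i k).
by apply: image_subset => x [xi /UW].
Qed.

End Manifold.
Arguments smooth_on {R} M U f.

Record smooth_fun (R : realType) (M : manifold R) := SmoothFun {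
  smooth_val :> M -> R;
  smooth_valP : smooth_on M setT smooth_val }.

Definition dprod (T : Type) (R : pzRingType) (F : T -> lmodType R) : Type :=
  forall x, F x.

Section DProd.
Context {T : Type} {R : pzRingType} {F : T -> lmodType R}.
Implicit Types u v w : dprod F.

HB.instance Definition _ := gen_eqMixin (dprod F).
HB.instance Definition _ := gen_choiceMixin (dprod F).

Let dprod_ext u v : (forall x, u x = v x) -> u = v.
Proof. exact: functional_extensionality_dep. Qed.

Let zero : dprod F := fun=> 0.
Let opp u : dprod F := fun x => - u x.
Let add u v : dprod F := fun x => u x + v x.
Let scale (c : R) u : dprod F := fun x => c *: u x.

Let addA : associative add.
Proof. by move=> u v w; apply: dprod_ext => x; exact: addrA. Qed.
Let addC : commutative add.
Proof. by move=> u v; apply: dprod_ext => x; exact: addrC. Qed.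
Let add0 : left_id zero add.
Proof. by move=> u; apply: dprod_ext => x; exact: add0r. Qed.
Let addN : left_inverse zero opp add.
Proof. by move=> u; apply: dprod_ext => x; exact: addNr. Qed.

HB.instance Definition _ := GRing.isZmodule.Build (dprod F) addA addC add0 addN.

Let scaleA a b u : scale a (scale b u) = scale (a * b) u.
Proof. by apply: dprod_ext => x; exact: scalerA. Qed.
Let scale1 : left_id 1 scale.
Proof. by move=> u; apply: dprod_ext => x; exact: scale1r. Qed.
Let scaleDr : right_distributive scale +%R.
Proof. by move=> a u v; apply: dprod_ext => x; exact: scalerDr. Qed.
Let scaleDl u : {morph scale^~ u : a b / a + b}.
Proof. by move=> a b; apply: dprod_ext => x; exact: scalerDl. Qed.

HB.instance Definition _ := GRing.Zmodule_isLmodule.Build R (dprod F)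
  scaleA scale1 scaleDr scaleDl.

End DProd.

(* A bundle given by its fibers, local trivializations [tmap a] over [tdom a]
   and smooth transition matrices; [tmap a x] is irrelevant for x outside of
   [tdom a]. *)
Record vbundle (R : realType) (M : manifold R) := VBundle {
  fiber :> M -> lmodType R;
  rank : nat;
  triv : Type;
  tdom : triv -> set M;
  tmap : triv -> forall x, {linear fiber x -> 'rV[R]_rank};
  ttrans : triv -> triv -> M -> 'M[R]_rank;
  tdom_open : forall a, open (tdom a);
  tdom_cover : forall x, exists a, tdom a x;
  tmap_bij : forall a x, tdom a x -> bijective (tmap a x);
  ttransE : forall a b x (e : fiber x), tdom a x -> tdom b x ->
    tmap b x e = tmap a x e *m ttrans a b x;
  ttrans_smooth : forall a b j k,
    smooth_on M (tdom a `&` tdom b) (fun x => ttrans a b x j k) }.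

Section Sections.
Context {R : realType} {M : manifold R} (E : vbundle M).

Definition smooth_section : {pred dprod E} := [pred u : dprod E |
  `[< forall (a : triv E) k,
        smooth_on M (tdom a) (fun x => tmap a x (u x) 0 k) >] ].

Lemma smooth_section_submod : submod_closed smooth_section.
Proof.
split=> [|c u v /asboolP us /asboolP vs].
  apply/asboolP => a k.
  have -> : (fun x => tmap a x ((0 : dprod E) x) 0 k) = cst 0.
    by apply/funext => x; rewrite linear0 mxE.
  exact: smooth_on_cst.
apply/asboolP => a k.
have -> : (fun x => tmap a x ((c *: u + v) x) 0 k) =
    (cst c \* (fun x => tmap a x (u x) 0 k)) \+ (fun x => tmap a x (v x) 0 k).
  by apply/funext => x; rewrite linearP !mxE.
have To := tdom_open a.
by apply: smooth_onD => //; apply: smooth_onM => //; exact: smooth_on_cst.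
Qed.

HB.instance Definition _ := GRing.isSubmodClosed.Build R (dprod E)
  smooth_section smooth_section_submod.

Record Gamma := Section_ {
  section_val :> forall x, E x;
  section_valP : section_val \in smooth_section }.

HB.instance Definition _ :=
  [isSub of Gamma for (section_val : Gamma -> dprod E)].
HB.instance Definition _ := [Choice of Gamma by <:].
HB.instance Definition _ := [SubChoice_isSubLmodule of Gamma by <:].

Lemma scale_fun_subproof (f : smooth_fun M) (u : Gamma) :
  ((fun x => f x *: u x) : dprod E) \in smooth_section.
Proof.
apply/asboolP => a k; have To := tdom_open a.
have -> : (fun x => tmap a x (f x *: u x) 0 k) =
    (f : M -> R) \* (fun x => tmap a x (u x) 0 k).
  by apply/funext => x; rewrite linearZ !mxE.
apply: smooth_onM => //; first exact: smooth_on_sub (smooth_valP f).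
by have /asboolP := section_valP u; exact.
Qed.

Definition scale_fun f u : Gamma := Section_ (scale_fun_subproof f u).

(* Packages a smooth u with its smoothness; 0 when u is not smooth, which does
   not happen in the uses below. *)
Definition mk_section (u : dprod E) : Gamma := insubd (0 : Gamma) u.

End Sections.
Arguments smooth_section {R M} E.

Section Omni.
Context {R : realType} {M : manifold R} (E : vbundle M).
Implicit Types (x : M) (u : Gamma E) (f : smooth_fun M).

(* The derivations f |-> (directional derivative of f at x along w), w being
   expressed in some chart around x. *)
Definition tangent_at x : set (smooth_fun M -> R) :=
  [set v | exists i : chart M, exists2 w : 'rV[R]_(mdim M), cdom i x &
    forall f, v f = 'd (f \o cinv i) (cmap i x) w].

Arguments tangent_at : clear implicits.

(* Smoothness of V is that of V f for all f. *)
Definition vector_field : set (smooth_fun M -> smooth_fun M) :=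
  [set V | forall x, tangent_at x (fun f => V f x)].

(* The fiber at x of the gauge algebroid: derivations at x of the module of
   sections. Sections of the gauge algebroid are directly operators, see
   [gauge_section]; [gauge_val D x] is the value at x of the section D. *)
Definition gauge_at x : set (Gamma E -> E x) :=
  [set d | linear d /\ exists2 v, tangent_at x v &
    forall f u, d (scale_fun f u) = f x *: d u + v f *: u x].

Arguments gauge_at : clear implicits.

Definition gauge_section : set (Gamma E -> Gamma E) :=
  [set D | linear D /\ exists2 V, vector_field V &
    forall f u, D (scale_fun f u) = scale_fun f (D u) + scale_fun (V f) u].

Definition gauge_val (D : Gamma E -> Gamma E) x : Gamma E -> E x :=
  fun u => D u x.

Definition commutator (D D' : Gamma E -> Gamma E) : Gamma E -> Gamma E :=
  fun u => D (D' u) - D' (D u).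

(* A 1-jet at x is recorded by its value in E x together with its first
   derivatives in all the charts i and trivializations a around x; hence two
   sections have the same [jet] at x iff they agree to first order at x. *)
Definition jet_space x : lmodType R :=
  (E x * (chart M -> triv E -> 'rV[R]_(mdim M) -> 'rV[R]_(rank E)))%type.

Definition jet u x : jet_space x :=
  (u x, fun i a v =>
     if `[< cdom i x /\ tdom a x >] then
       'd (fun z => tmap a (cinv i z) (u (cinv i z))) (cmap i x) v
     else 0).

Definition jet_at x : set (jet_space x) := range (jet^~ x).

Arguments jet_at : clear implicits.

(* Smoothness is that of the coordinates of the jet bundle induced by charts of
   M and trivializations of E. *)
Definition jet_section : set (dprod jet_space) :=
  [set mu | [/\ forall x, jet_at x (mu x),
    smooth_section E (fun x => (mu x).1) &
    forall (i : chart M) (a : triv E) v k,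
      smooth_on M (cdom i `&` tdom a) (fun x => (mu x).2 i a v 0 k)]].

Definition prolongation u : dprod jet_space := jet u.

(* <jet u x, d> = d u. Any u representing the jet m may be used, as an element
   of [gauge_at x] only depends on 1-jets at x. *)
Definition jet_pairing x (m : jet_space x) (d : Gamma E -> E x) : E x :=
  d (xget 0 [set u | jet u x = m]).

Definition pairing (mu : dprod jet_space) (D : Gamma E -> Gamma E) : Gamma E :=
  mk_section (fun x => jet_pairing (mu x) (gauge_val D x)).

(* the section of the jet bundle characterized by
   <L_D mu, D'> = D <mu, D'> - <mu, [D, D']>  for all D' *)
Definition lie_derivative (D : Gamma E -> Gamma E) (mu : dprod jet_space) :
    dprod jet_space :=
  xget 0 [set mu' | jet_section mu' /\ forall D', gauge_section D' ->
    pairing mu' D' = D (pairing mu D') - pairing mu (commutator D D')].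

Definition omni_space x : lmodType R :=
  ((Gamma E -> E x) * jet_space x)%type.

Definition omni_at x : set (omni_space x) :=
  [set e | gauge_at x e.1 /\ jet_at x e.2].

Arguments omni_at : clear implicits.

Definition omni : Type :=
  ((Gamma E -> Gamma E) * dprod jet_space)%type.

Definition omni_section : set omni :=
  [set X | gauge_section X.1 /\ jet_section X.2].

Definition omni_val (X : omni) x : omni_space x := (gauge_val X.1 x, X.2 x).

Definition omni_bracket (X Y : omni) : omni :=
  (commutator X.1 Y.1,
   lie_derivative X.1 Y.2 - lie_derivative Y.1 X.2
     + prolongation (pairing X.2 Y.1)).

Definition omni_pairing x (e e' : omni_space x) : E x :=
  2^-1 *: (jet_pairing e'.2 e.1 + jet_pairing e.2 e'.1).

Implicit Types (C L : forall x, set (omni_space x)) (X Y l : omni).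

(* A frame over a small open set is the restriction of global sections, hence
   the use of global s j. *)
Definition subbundle C :=
  (forall x, C x `<=` omni_at x) /\
  exists k : nat, forall x0, exists (U : set M) (s : 'I_k -> omni),
    [/\ open U, U x0, forall j, omni_section (s j) &
      forall x, U x ->
        (forall c : 'I_k -> R,
           \sum_j c j *: omni_val (s j) x = 0 -> forall j, c j = 0) /\
        C x = [set \sum_j c j *: omni_val (s j) x | c in [set: 'I_k -> R]]].

Definition subbundle_section C : set omni :=
  [set X | omni_section X /\ forall x, C x (omni_val X x)].

Definition orthogonal_bundle C x : set (omni_space x) :=
  [set e | omni_at x e /\ forall s, C x s -> omni_pairing e s = 0].

Arguments orthogonal_bundle : clear implicits.

(* Maximal isotropy is taken in the form L = L^perp, fiberwise. *)
Definition dirac_structure L :=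
  [/\ subbundle L, forall x, L x = orthogonal_bundle L x &
    forall X Y, subbundle_section L X -> subbundle_section L Y ->
      subbundle_section L (omni_bracket X Y)].

Definition normalizer C : set omni :=
  [set X | omni_section X /\ forall Y, subbundle_section C Y ->
    subbundle_section C (omni_bracket X Y)].

(* For a bundle map w : L -> E; only the values of w x on L x matter. *)
Definition cochain1 := forall x, omni_space x -> E x.

Definition cochain1_app (w : cochain1) l : Gamma E :=
  mk_section (fun x => w x (omni_val l x)).

Definition coboundary (w : cochain1) l1 l2 : Gamma E :=
  l1.1 (cochain1_app w l2) - l2.1 (cochain1_app w l1)
    - cochain1_app w (omni_bracket l1 l2).

Definition cochain2_eq0 L (W : omni -> omni -> Gamma E) :=
  forall l1 l2, subbundle_section L l1 -> subbundle_section L l2 ->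
    W l1 l2 = 0.

Definition omega X : cochain1 := fun x => omni_pairing (omni_val X x).

End Omni.

(* Main.v *)
(* Write X = d + mu and l_k = d_k + mu_k.  Expanding the bracket with the formula
   <L_d mu, d'> = d <mu, d'> - <mu, [d, d']> gives, for arbitrary sections, the identity
   (d_L omega_X)(l_1, l_2) = - ({X, l_1}, l_2).  Hence d_L omega_X = 0 iff every {X, l_1}
   is orthogonal to the sections of L, that is, to L itself since each element of L
   extends to a section of L by a cutoff; and L^perp = L.
   The work lies in showing that the pairing, the commutator and the Lie derivative are
   well behaved.  An element of the gauge algebroid at x only sees 1-jets at x, so near a
   point every jet section pairs like a finite combination of f_j (jet of u_j), and the
   Lie derivative is given there by f_j (jet of D u_j) + (V f_j) (jet of u_j).  Its
   smoothness is read off from its pairing with coordinate derivations.  The commutator of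
   two vector fields is a vector field by symmetry of second derivatives. *)
Require Import Defs.
From HB Require Import structures.
From mathcomp Require Import all_boot all_order all_algebra.
From mathcomp Require Import all_classical all_reals all_analysis.
From mathcomp Require Import ring lra.

Set Implicit Arguments.
Unset Strict Implicit.
Unset Printing Implicit Defensive.

Import Order.TTheory GRing.Theory Num.Theory.
Import numFieldNormedType.Exports.

Local Open Scope classical_set_scope.
Local Open Scope ring_scope.

(** * Iterated differentiability and symmetry of second derivatives *)

Section Calculus.
Context {R : realType}.

Lemma Ck_differentiable k (V : normedModType R) (U : set V) f x :
  Ck k.+1 U f -> U x -> differentiable f x.
Proof. by case=> df _; exact: df. Qed.

Lemma Ck_sum k (V : normedModType R) (U : set V) (I : Type) (r : seq I)
    (F : I -> V -> R) : open U -> (forall j, Ck k U (F j)) ->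
  Ck k U (fun x => \sum_(j <- r) F j x).
Proof.
move=> Uo Fk; elim: r => [|j r IH].
  by rewrite (_ : (fun x => _) = cst 0) ?funeqE => [|x]; [exact: Ck_cst|rewrite big_nil].
rewrite (_ : (fun x => _) = F j \+ (fun x => \sum_(j <- r) F j x)); last first.
  by apply/funext => x; rewrite big_cons.
exact: CkD.
Qed.

Lemma Ck_local k (V : normedModType R) (U : set V) f :
  (forall x, U x -> exists W, [/\ open W, W x & Ck k W f]) -> Ck k U f.
Proof.
elim: k f => [|k IH] f loc.
  by move=> x /loc[W [_ Wx]]; exact.
split=> [x /loc[W [_ Wx [dW _]]]|v]; first exact: dW.
by apply: IH => x /loc[W [Wo Wx [_ dW]]]; exists W; split => //; exact: dW.
Qed.

Lemma Ck_linear k (V : normedModType R) (U : set V) (f : {linear V -> R}) :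
  continuous f -> Ck k U f.
Proof.
move=> fc; case: k => [|k]; first by move=> x _; exact: fc.
split=> [x _|v]; first exact: linear_differentiable.
rewrite (_ : (fun x => _) = cst (f v)); first exact: Ck_cst.
by apply/funext => x; rewrite diff_lin.
Qed.

Lemma Ck_coord k n (U : set 'rV[R]_n) (j : 'I_n) :
  Ck k U (fun z : 'rV[R]_n => z 0 j).
Proof.
have @f : {linear 'rV[R]_n -> R}.
  by exists (fun N : 'rV[R]_n => N 0 j); do 2![eexists]; do ?[constructor];
     rewrite ?mxE// => ? *; rewrite ?mxE//; move=> ?; rewrite !mxE.
by rewrite (_ : (fun _ => _) = f) //; apply: Ck_linear; exact: coord_continuous.
Qed.

Section LinearCombinations.
Context {V W : normedModType R} (n : nat) (e : 'I_n -> W).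

Lemma is_diff_lincomb (c : 'I_n -> V -> R) x :
  (forall j, differentiable (c j) x) ->
  differentiable (fun y => \sum_j c j y *: e j) x /\
  forall v, 'd (fun y => \sum_j c j y *: e j) x v = \sum_j 'd (c j) x v *: e j.
Proof.
elim: n e c => [|m IH] e' c cd.
  rewrite (_ : (fun y => _) = cst 0); last by apply/funext => y; rewrite big_ord0.
  split; first exact: differentiable_cst.
  by move=> v; rewrite big_ord0 diff_cst.
rewrite (_ : (fun y => _) = (fun y => c ord0 y *: e' ord0) +
   (fun y => \sum_j c (lift ord0 j) y *: e' (lift ord0 j))); last first.
  by apply/funext => y; rewrite big_ord_recl.
have [d1 d2] := IH (e' \o lift ord0) (c \o lift ord0) (fun j => cd _).
have d0 := @differentiableZl R V W _ (e' ord0) x (cd ord0).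
split; first exact: differentiableD.
move=> v; rewrite diffD//= [in LHS]/= big_ord_recl -d2.
congr (_ + _); by have /(congr1 (@^~ v)) := diffZl (e' ord0) (cd ord0).
Qed.

(** Expanding the inner map along fixed vectors [e j] turns the derivative of the composite into a
    finite sum of products of ['d (c j) x v] and ['d f (g x) (e j)]. Only directional derivatives of
    [f] along fixed vectors occur, and these are what [Ck] controls, so the induction on [k]
    closes. *)
Lemma Ck_comp k (U : set V) (U' : set W) (f : W -> R) (g : V -> W)
    (c : 'I_n -> V -> R) : open U -> open U' ->
  (forall x, U x -> U' (g x)) -> (forall x, U x -> g x = \sum_j c j x *: e j) ->
  (forall j, Ck k U (c j)) -> Ck k U' f -> Ck k U (f \o g).
Proof.
move=> Uo U'o gU gE ck fk.
have gE' x : U x -> \near x, (\sum_j c j x *: e j) = g x.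
  by move=> Ux; near=> y; rewrite gE//; near: y; exact: open_nbhs_nbhs.
suff H : Ck k U (f \o (fun x => \sum_j c j x *: e j)).
  by apply: Ck_ext H => // x Ux; rewrite /= gE.
have gU' x : U x -> U' (\sum_j c j x *: e j) by move=> Ux; rewrite -gE//; exact: gU.
elim: k f ck fk => [|k IH] f ck fk.
  move=> x Ux; apply: continuous_comp; last exact/fk/gU'.
  rewrite /continuous_at; apply: (@cvg_big _ _ +%R) => //; first exact: add_continuous.
  by move=> j _; exact: cvgZr_tmp (ck j x Ux).
have dc x : U x -> forall j, differentiable (c j) x.
  by move=> Ux j; exact: Ck_differentiable (ck j) Ux.
have df x : U x -> differentiable f (\sum_j c j x *: e j).
  by move=> Ux; exact: Ck_differentiable fk (gU' x Ux).
split=> [x Ux|v].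
  apply: differentiable_comp; last exact: df.
  by have [] := is_diff_lincomb (dc x Ux).
have H : Ck k U (fun x => \sum_j 'd (c j) x v *
    (((fun y => 'd f y (e j)) \o (fun x => \sum_j c j x *: e j)) x)).
  apply: Ck_sum => // j; apply: (@CkM _ _ k U (fun x => 'd (c j) x v)) => //.
    by have [_] := ck j; exact.
  apply: IH; first by move=> ?; exact: CkS.
  by have [_] := fk; exact.
apply: Ck_ext H => // x Ux; have [d1 d2] := is_diff_lincomb (dc x Ux).
rewrite diff_comp//=; last exact: df.
by rewrite d2 linear_sum; apply: eq_bigr => j _; rewrite linearZ.
Unshelve. all: by end_near. Qed.

End LinearCombinations.

Lemma diff_row (V : normedModType R) n (g : V -> 'rV[R]_n) x :
  (forall j, differentiable (fun y => g y 0 j) x) ->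
  differentiable g x /\
  forall v j, 'd g x v 0 j = 'd (fun y => g y 0 j) x v.
Proof.
move=> gd; have [d1 d2] := is_diff_lincomb (fun j : 'I_n => delta_mx 0 j : 'rV[R]_n) gd.
have gE : g = (fun y => \sum_j g y 0 j *: (delta_mx 0 j : 'rV[R]_n)).
  by apply/funext => y; exact: row_sum_delta.
rewrite -gE in d1 d2; split=> // v j; rewrite d2 summxE (bigD1 j)//= big1 ?addr0.
  by rewrite !mxE !eqxx mulr1.
by move=> l lj; rewrite !mxE eqxx (eq_sym j) (negbTE lj) mulr0.
Qed.

Lemma Ck_comp_row k (V : normedModType R) n (U : set V) (U' : set 'rV[R]_n)
    (f : 'rV[R]_n -> R) (g : V -> 'rV[R]_n) : open U -> open U' ->
  (forall x, U x -> U' (g x)) -> (forall j, Ck k U (fun x => g x 0 j)) ->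
  Ck k U' f -> Ck k U (f \o g).
Proof.
move=> Uo U'o gU gk fk; apply: (Ck_comp (e := fun j : 'I_n => delta_mx 0 j)) gk fk => //.
by move=> x _; exact: row_sum_delta.
Qed.

Lemma Ck_comp_real k (V : normedModType R) (U : set V) (h : R -> R) (g : V -> R) :
  open U -> Ck k U g -> Ck k [set: R] h -> Ck k U (h \o g).
Proof.
move=> Uo gk hk.
apply: (Ck_comp (e := fun j : 'I_1 => 1 : R) (c := fun=> g) (U' := setT)) => //.
- exact: openT.
- by move=> x _; rewrite big_ord1 /GRing.scale /= mulr1.
Qed.

(** * Mean values along segments and Schwarz's theorem *)

Lemma diff_shift (V : normedModType R) (f : V -> R) (a x v : V) :
  differentiable f (x + a) ->
  differentiable (fun y => f (y + a)) x /\
  'd (fun y => f (y + a)) x v = 'd f (x + a) v.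
Proof.
have shiftE : (fun y => y + a) = (id : V -> V) + cst a by apply/funext.
have idd : differentiable (id : V -> V) x by case: (is_diff_id x).
move=> df; have sd : differentiable (fun y => y + a) x.
  by rewrite shiftE; apply: differentiableD idd _; exact: differentiable_cst.
rewrite (_ : (fun y => f (y + a)) = f \o (fun y => y + a))//.
split; first exact: differentiable_comp.
rewrite diff_comp//= [X in 'd X x]shiftE diffD//.
by rewrite diff_cst (@diff_val _ _ _ _ _ _ _ (is_diff_id x)) /= addr0.
Qed.

(** The one-variable mean value theorem for [fun t => f (x + t *: v)], whose derivative is given by
    the chain rule. *)
Lemma mvt_line (V : normedModType R) (f : V -> R) (x v : V) (s : R) : 0 < s ->
  (forall t, 0 <= t <= s -> differentiable f (x + t *: v)) ->
  exists2 c, 0 < c < s & f (x + s *: v) - f x = s * 'd f (x + c *: v) v.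
Proof.
move=> s0 df; pose g (t : R) := f (x + t *: v).
have lineE : (fun t : R => x + t *: v) = cst x + (fun t : R => t *: v) by apply/funext.
have idd (t : R) : differentiable (id : R -> R) t by case: (is_diff_id t).
have ld (t : R) : differentiable (fun t : R => x + t *: v) t.
  rewrite lineE; apply: differentiableD (differentiable_cst x t) _.
  exact: (differentiableZl v (idd t)).
have ldE (t h : R) : 'd (fun t : R => x + t *: v) t h = h *: v.
  rewrite lineE diffD; [|by []|exact: (differentiableZl v (idd t))].
  rewrite diff_cst /= add0r.
  have /(congr1 (@^~ h)) -> := diffZl v (idd t).
  by rewrite (@diff_val _ _ _ _ _ _ _ (is_diff_id t)).
have gd (t : R) : 0 <= t <= s -> differentiable g t.
  move=> /df dft.
  by rewrite (_ : g = f \o (fun t : R => x + t *: v)); [exact: differentiable_comp|].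
have gd1 (t : R) : 0 <= t <= s -> is_derive t 1 g ('d f (x + t *: v) v).
  move=> ts; apply: DeriveDef; first exact/derivable1_diffP/gd.
  rewrite deriveE; last exact: gd.
  rewrite (_ : g = f \o (fun t : R => x + t *: v))// diff_comp//; last exact: df.
  by rewrite /= ldE scale1r.
have [||c /itvP cs cE] := @MVT R g (fun t => 'd f (x + t *: v) v) 0 s s0.
- by move=> t /itvP ts; apply: gd1; rewrite !ts.
- apply: derivable_within_continuous => t /itvP ts.
  by apply/derivable1_diffP/gd; rewrite !ts.
exists c; first by rewrite !cs.
by rewrite mulrC -[X in _ * X](subr0 s) -cE /g scale0r addr0.
Qed.

(** The mean value theorem is applied along [v] to the increment [f (y + s *: w) - f y], then along
    [w] to the derivative ['d f y v]. The bound on [s] keeps the whole parallelogram inside the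
    ball. The second difference on the left is symmetric in [v] and [w], which is the point of the
    lemma. *)
Lemma mixed_difference (V : normedModType R) (f : V -> R) (x v w : V) (r s : R) :
  Ck 2 (ball x r) f -> 0 < s -> s * (`|v| + `|w|) < r ->
  exists2 p, ball x r p & f (x + s *: v + s *: w) - f (x + s *: v) -
     (f (x + s *: w) - f x) = s * (s * 'd (fun y => 'd f y v) p w).
Proof.
move=> fk s0 sr.
have inb a b : 0 <= a <= s -> 0 <= b <= s -> ball x r (x + a *: v + b *: w).
  move=> /andP[a0 as_] /andP[b0 bs]; rewrite -ball_normE /ball_ /=.
  rewrite -addrA opprD addrA subrr sub0r normrN; apply: le_lt_trans sr.
  rewrite (le_trans (ler_normD _ _))// !normrZ !ger0_norm// mulrDr.
  by apply: lerD; apply: ler_wpM2r.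
have s00 : 0 <= (0 : R) <= s by apply/andP; split => //; exact: ltW.
have s01 : 0 <= s <= s by apply/andP; split => //; exact: ltW.
have inb0 a : 0 <= a <= s -> ball x r (x + a *: v).
  by move=> /inb/(_ s00); rewrite scale0r addr0.
have df := Ck_differentiable fk.
pose g y := f (y + s *: w) - f y.
have gd y : ball x r (y + s *: w) -> ball x r y -> differentiable g y /\
    'd g y v = 'd f (y + s *: w) v - 'd f y v.
  move=> b1 b2; have [d1 d2] := diff_shift v (df _ b1).
  split; first exact: differentiableB d1 (df _ b2).
  by rewrite -d2; have /(congr1 (@^~ v)) := diffB d1 (df _ b2).
have [t ts|c /andP[c0 cs] cE] := mvt_line (f := g) (x := x) (v := v) s0.
  by have [] := gd _ (inb _ _ ts s01) (inb0 _ ts).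
have cs' : 0 <= c <= s by rewrite !ltW.
have fk1 : Ck 1 (ball x r) (fun y => 'd f y v) by case: fk => _; exact.
have [t ts|b /andP[b0 bs] bE] :=
  mvt_line (f := fun y => 'd f y v) (x := x + c *: v) (v := w) s0.
  by apply: (Ck_differentiable fk1); exact: inb.
exists (x + c *: v + b *: w); first by apply: inb; rewrite // !ltW.
rewrite -bE -[LHS]/(g (x + s *: v) - g x) cE; congr (_ * _).
by have [_ ->] := gd _ (inb _ _ cs' s01) (inb0 _ cs').
Qed.

(** By symmetry of the second difference, the two mixed derivatives take a common value, one at a
    point [p] and the other at a point [q] of an arbitrarily small ball; their continuity, part of
    [Ck 2], carries this over to [x] up to any [e]. *)
Lemma diff_sym (V : normedModType R) (U : set V) (f : V -> R) (x v w : V) :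
  open U -> U x -> Ck 2 U f ->
  'd (fun y => 'd f y v) x w = 'd (fun y => 'd f y w) x v.
Proof.
move=> Uo Ux fk; apply/eqP; rewrite -subr_eq0 -normr_eq0 eq_le normr_ge0 andbT.
apply/ler_addgt0Pl => e e0; rewrite addr0.
have cont a b : {for x, continuous (fun y => 'd (fun y => 'd f y a) y b)}.
  by have [_ /(_ a)[_ /(_ b)]] := fk; exact.
have e20 : 0 < e / 2 by rewrite divr_gt0.
have : nbhs x [set y | [/\ U y,
   `|'d (fun y => 'd f y v) x w - 'd (fun y => 'd f y v) y w| < e / 2 &
   `|'d (fun y => 'd f y w) x v - 'd (fun y => 'd f y w) y v| < e / 2]].
  have /cvgrPdist_lt/(_ _ e20) h1 := cont v w.
  have /cvgrPdist_lt/(_ _ e20) h2 := cont w v.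
  near=> y; split; [|by near: y..].
  by near: y; exact: open_nbhs_nbhs.
move=> /nbhs_ballP[r /= r0 rP].
have fkr : Ck 2 (ball x r) f by apply: Ck_sub fk => y /rP[].
(* The summand 1 keeps the denominator positive when [v] and [w] vanish and makes the bound [sr]
   strict. *)
pose s := r / (`|v| + `|w| + 1).
have n0 : 0 < `|v| + `|w| + 1 by rewrite ltr_wpDl// addr_ge0.
have s0 : 0 < s by rewrite divr_gt0.
have sr : s * (`|v| + `|w|) < r.
  by rewrite /s mulrAC ltr_pdivrMr// ltr_pM2l// ltrDl.
have [p /rP[_ + _] pE] := mixed_difference fkr s0 sr.
have sr' : s * (`|w| + `|v|) < r by rewrite addrC.
have [q /rP[_ _] + qE] := mixed_difference fkr s0 sr'.
have pq : 'd (fun y => 'd f y v) p w = 'd (fun y => 'd f y w) q v.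
  apply: (mulfI (lt0r_neq0 s0)); apply: (mulfI (lt0r_neq0 s0)).
  by rewrite -pE -qE (addrAC x); ring.
rewrite pq distrC => h1 h2.
rewrite distrC -(subrKA ('d (fun y => 'd f y w) q v)) ltW//.
rewrite (le_lt_trans (ler_normD _ _))// [ltRHS](splitr e).
by rewrite ltrD// distrC.
Unshelve. all: by end_near. Qed.

End Calculus.

(** * Bump functions *)

Section Bump.
Context {R : realType}.

Lemma diff_flat (V : normedModType R) (h : V -> R) (x : V) :
  (forall e, 0 < e -> \forall y \near 0, `|h (y + x) - h x| <= e * `|y|) ->
  differentiable h x /\ 'd h x = 0 :> (V -> R).
Proof.
move=> hlip.
have hE : h \o shift x = cst (h x) + (\0 : V -> R) +o_ 0 id.
  apply/eqaddoP => _/posnumP[e].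
  have := hlip _ (ltac:(done) : 0 < e%:num).
  by apply: filterS => y; rewrite /= !fctE /= addr0.
have d0 : 'd h x = \0 :> (V -> R).
  by apply: diff_unique => // y; exact: cvg_cst.
by split => //; apply/diff_locallyP; rewrite d0; split => // y; exact: cvg_cst.
Qed.

(** The classical function exp(-1/t), extended by 0. The extra powers of 1/t make the family stable
    under differentiation up to linear combinations. *)
Definition flat (n : nat) (t : R) : R :=
  if 0 < t then expR (- t^-1) * t^-1 ^+ n else 0.

Lemma flat_pos n t : 0 < t -> 0 < flat n t.
Proof. by move=> t0; rewrite /flat t0 mulr_gt0 ?expR_gt0// exprn_gt0 ?invr_gt0. Qed.

Lemma flat_npos n t : t <= 0 -> flat n t = 0.
Proof. by move=> t0; rewrite /flat ltNge t0. Qed.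

Lemma flat_ge0 n t : 0 <= flat n t.
Proof. by case: (ltP 0 t) => t0; [rewrite ltW ?flat_pos|rewrite flat_npos]. Qed.

(** The exponential of 1/t dominates the term of degree [n.+2] of its series. The remaining factor
    [t ^+ 2] gives the derivative 0 at the origin. *)
Lemma flat_le n t : 0 <= t -> flat n t <= (n.+2)`!%:R * t ^+ 2.
Proof.
rewrite le_eqVlt => /predU1P[<-|t0]; first by rewrite flat_npos// expr0n mulr0.
have t'0 : 0 < t^-1 by rewrite invr_gt0.
rewrite /flat t0 expRN mulrC ler_pdivrMr ?expR_gt0//.
have := @expR_ge1Dxn R t^-1 n.+1 (ltW t'0); set e := expR _ => ge1.
have f0 : 0 < (n.+2)`!%:R :> R by rewrite ltr0n fact_gt0.
have ge : t^-1 ^+ n.+2 <= (n.+2)`!%:R * e.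
  rewrite mulrC -ler_pdivrMr//; apply: le_trans ge1.
  by rewrite lerDr.
rewrite mulrAC -ler_pdivrMr ?exprn_gt0// -exprVn -exprD addn2.
exact: ge.
Qed.

(** For negative [t] the function is locally zero; for positive [t] the product and chain rules
    apply; at 0 the quadratic bound [flat_le] forces the derivative to vanish. Since the derivative
    is again a combination of members of the family, smoothness follows by induction. *)
Lemma flat_diff n t : differentiable (flat n) t /\
  forall v, 'd (flat n) t v = v * (flat n.+2 t - n%:R * flat n.+1 t).
Proof.
case: (ltgtP t 0) => t0.
- have [|d1 d2] := @near0_diff R R (flat n) t.
    near=> y; rewrite flat_npos// ltW//; near: y.
    exact: lt_nbhsl.
  by split=> // v; rewrite d2 !flat_npos ?(ltW t0)// mulr0 subrr mulr0.
- pose g (s : R) := expR (- s^-1) * s^-1 ^+ n.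
  have gflat : \near t, g t = flat n t.
    near=> s; rewrite /flat /g ifT//; near: s; exact: lt_nbhsr.
  have dg : is_derive t 1 g (flat n.+2 t - n%:R * flat n.+1 t).
    have di : is_derive t 1 (fun s : R => s^-1) (- t ^- 2).
      apply: DeriveDef; first by apply: derivableV => //; rewrite gt_eqF.
      rewrite deriveV; [|by rewrite gt_eqF|exact: derivable_id].
      by rewrite derive_id /GRing.scale /= mulr1.
    have dn : is_derive t 1 (fun s : R => - s^-1) (t ^- 2).
      by rewrite -[t ^- 2]opprK; exact: (is_deriveN (f := fun s : R => s^-1)).
    have de : is_derive t 1 (fun s => expR (- s^-1)) (t ^- 2 * expR (- t^-1)).
      have e0 := is_derive_expR (- t^-1).
      by rewrite mulrC; exact: (is_derive1_comp (f := expR) (g := fun s => - s^-1) e0 dn).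
    have dx : is_derive t 1 (fun s : R => s^-1 ^+ n) (n%:R * t^-1 ^+ n.-1 * - t ^- 2).
      rewrite (_ : (fun s => _) = (fun s : R => s^-1) ^+ n); last first.
        by apply/funext => s /=; rewrite exprfctE.
      exact: (is_deriveX (f := fun s : R => s^-1) n di).
    rewrite (_ : _ - _ = expR (- t^-1) *: (n%:R * t^-1 ^+ n.-1 * - t ^- 2) +
        t^-1 ^+ n *: (t ^- 2 * expR (- t^-1))).
      by have := is_deriveM de dx.
    rewrite /flat t0 /GRing.scale /= -exprVn.
    case: n {gflat g dx} => [|m] /=; first by rewrite expr0; ring.
    by rewrite !exprS; ring.
  have dg1 : differentiable g t by apply/derivable1_diffP; case: dg.
  have [d1 d2] := near_eq_diff gflat dg1.
  split=> // v; rewrite d2 -[v in LHS]mulr1 linearZ /= -deriveE//.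
  by congr (_ * _); case: dg.
- rewrite t0; have [|d1 d2] := @diff_flat R (flat n) 0.
    move=> e e0; have f0 : 0 < (n.+2)`!%:R :> R by rewrite ltr0n fact_gt0.
    near=> y; rewrite addr0 (@flat_npos n 0)// subr0 ger0_norm ?flat_ge0//.
    case: (leP y 0) => y0; first by rewrite flat_npos// mulr_ge0// ltW.
    rewrite (le_trans (flat_le _ (ltW y0)))// expr2 mulrA gtr0_norm//.
    apply: ler_wpM2r; first exact: ltW.
    rewrite -ler_pdivlMl// mulrC -[y]gtr0_norm//.
    near: y; exact: (@pseudometric_normed_Zmodule.nbhs0_le R R _ (divr_gt0 e0 f0)).
  by split=> // v; rewrite d2 !flat_npos// mulr0 subrr mulr0.
Unshelve. all: by end_near. Qed.

Lemma Ck_flat k n : Ck k [set: R] (flat n).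
Proof.
elim: k n => [|k IH] n.
  by move=> x _; apply: differentiable_continuous; have [] := flat_diff n x.
split=> [x _|v]; first by have [] := flat_diff n x.
rewrite (_ : (fun x => _) = cst v \* (flat n.+2 \+ (cst (- n%:R) \* flat n.+1))).
  have To := @openT R.
  exact: (CkM To (Ck_cst _ _ _) (CkD To (IH _) (CkM To (Ck_cst _ _ _) (IH _)))).
by apply/funext => x; rewrite (flat_diff n x).2 /= mulNr.
Qed.

(* Nesting [flat] yields a function that is constant on both sides of [0, 1] without
   the usual division of one smooth function by another. *)
Definition step (t : R) : R := (flat 0 (flat 0 1))^-1 * flat 0 (flat 0 1 - flat 0 t).

Lemma step1 t : t <= 0 -> step t = 1.
Proof.
move=> t0; rewrite /step (flat_npos 0 t0) subr0 mulVf//.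
by rewrite gt_eqF// !flat_pos.
Qed.

Lemma step0 t : 1 <= t -> step t = 0.
Proof.
move=> t1; have t0 : 0 < t by exact: lt_le_trans t1.
rewrite /step (@flat_npos _ (_ - _)) ?mulr0// subr_le0.
by rewrite /flat ltr01 t0 !expr0 !mulr1 ler_expR lerN2 lef_pV2 ?posrE.
Qed.

Lemma Ck_step k : Ck k [set: R] step.
Proof.
rewrite (_ : step = cst ((flat 0 (flat 0 1))^-1) \*
    (flat 0 \o (cst (flat 0 1) \+ (cst (-1) \* flat 0)))); last first.
  by apply/funext => t; rewrite /step /= mulN1r.
have To := @openT R.
apply: (CkM To (Ck_cst _ _ _)); apply: (Ck_comp_real To _ (Ck_flat _ _)).
exact: (CkD To (Ck_cst _ _ _) (CkM To (Ck_cst _ _ _) (Ck_flat _ _))).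
Qed.

Lemma bump_rV n (c : 'rV[R]_n) (r : R) : 0 < r -> exists B : 'rV[R]_n -> R,
  [/\ Cinfty setT B,
      forall z : 'rV[R]_n, (forall j, `|z 0 j - c 0 j| <= r) -> B z = 1 &
      forall (z : 'rV[R]_n) j, 2 * r <= `|z 0 j - c 0 j| -> B z = 0].
Proof.
(* The square stands for the absolute value, which is not smooth. Within distance [r] one has
   [q j z <= 0], where [step] is 1; at distance at least [2 * r] one has [q j z >= 3], where [step]
   is 0. *)
move=> r0; pose q (j : 'I_n) (z : 'rV[R]_n) := ((z 0 j - c 0 j) / r) ^+ 2 - 1.
exists (fun z => \prod_j step (q j z)); split.
- move=> k; have To := @openT 'rV[R]_n.
  have qk j : Ck k setT (q j).
    rewrite (_ : q j = ((((fun z : 'rV[R]_n => z 0 j) \+ cst (- c 0 j)) \* cst r^-1) \*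
      (((fun z : 'rV[R]_n => z 0 j) \+ cst (- c 0 j)) \* cst r^-1)) \+ cst (-1))//.
    have lin : Ck k setT (((fun z : 'rV[R]_n => z 0 j) \+ cst (- c 0 j)) \* cst r^-1).
      exact: (CkM To (CkD To (Ck_coord _ _ _) (Ck_cst _ _ _)) (Ck_cst _ _ _)).
    exact: (CkD To (CkM To lin lin) (Ck_cst _ _ _)).
  elim: (index_enum _) => [|j s IH].
    rewrite (_ : (fun z => _) = cst 1); first exact: Ck_cst.
    by apply/funext => z; rewrite big_nil.
  rewrite (_ : (fun z => _) = (step \o q j) \* (fun z => \prod_(j <- s) step (q j z))).
    exact: (CkM To (Ck_comp_real To (qk j) (Ck_step k)) IH).
  by apply/funext => z; rewrite big_cons.
- move=> z zr; rewrite big1// => j _; apply: step1.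
  rewrite subr_le0 -real_normK ?num_real// normrM normfV (gtr0_norm r0).
  by rewrite expr_le1// ?divr_ge0 ?(ltW r0)// ler_pdivrMr// mul1r.
- move=> z j zr; rewrite (bigD1 j)//= step0 ?mul0r//.
  rewrite lerBrDr -real_normK ?num_real// normrM normfV (gtr0_norm r0).
  have : 2 <= `|z 0 j - c 0 j| / r by rewrite ler_pdivlMr.
  by move=> h; rewrite (le_trans _ (lerXn2r 2 _ _ h)) ?nnegrE ?divr_ge0 ?(ltW r0)//; lra.
Qed.

End Bump.

(** * Smooth functions and vector fields on manifolds *)

Section ManifoldTheory.
Context {R : realType} {M : manifold R}.
Implicit Types (U W : set M) (i : chart M) (x : M).

Lemma smooth_on_ext U (f g : M -> R) : open U -> (forall x, U x -> f x = g x) ->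
  smooth_on M U f -> smooth_on M U g.
Proof.
move=> Uo fg fs i k; apply: Ck_ext (fs i k); first exact: cimgI_open.
by move=> _ [x [xi Ux] <-]; rewrite /= cmapK//; exact: fg.
Qed.

Lemma smooth_on_eq0 U (f : M -> R) : open U -> (forall x, U x -> f x = 0) ->
  smooth_on M U f.
Proof.
move=> Uo f0; apply: (smooth_on_ext (f := cst 0) Uo) => [x /f0 ->//|].
exact: smooth_on_cst.
Qed.

Lemma smooth_on_local U (f : M -> R) :
  (forall x, U x -> exists W, [/\ open W, W x & smooth_on M W f]) ->
  smooth_on M U f.
Proof.
move=> loc i k; apply: Ck_local => _ [x [xi Ux] <-].
have [W [Wo Wx Ws]] := loc x Ux.
by exists (cmap i @` (cdom i `&` W)); split; [exact: cimgI_open|exists x|exact: Ws].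
Qed.

Lemma smooth_on_sum U (I : Type) (r : seq I) (F : I -> M -> R) : open U ->
  (forall j, smooth_on M U (F j)) -> smooth_on M U (fun x => \sum_(j <- r) F j x).
Proof.
move=> Uo Fs i k.
exact: (Ck_sum (F := fun j => F j \o cinv i) r (cimgI_open (i := i) Uo)
  (fun j => Fs j i k)).
Qed.

Lemma smooth_on_diff U (f : M -> R) i x : smooth_on M U f -> cdom i x -> U x ->
  differentiable (f \o cinv i) (cmap i x).
Proof. by move=> fs xi Ux; apply: (Ck_differentiable (fs i 1%N)); exists x. Qed.

Lemma cmap_coord_smooth i k : smooth_on M (cdom i) (fun x => cmap i x 0 k).
Proof. by move=> j; exact: ctrans_smooth. Qed.

(** In any other chart the function is the composite of its expression in the chart [i] with a
    smooth transition map. *)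
Lemma smooth_on_chart i U (f : M -> R) : open U -> U `<=` cdom i ->
  Cinfty (cmap i @` U) (f \o cinv i) -> smooth_on M U f.
Proof.
move=> Uo Ui fs j k.
have Wo := cimgI_open (i := j) Uo.
apply: (@Ck_ext _ _ k _ ((f \o cinv i) \o (fun z => cmap i (cinv j z)))) => //.
  by move=> _ [x [xj Ux] <-]; rewrite /= cmapK// cmapK//; exact: Ui.
apply: (Ck_comp_row (U' := cmap i @` U)) => //.
- by rewrite -(setIidr Ui); exact: cimgI_open.
- by move=> _ [x [xj Ux] <-]; rewrite /= cmapK//; exists x.
- move=> l; apply: Ck_sub (ctrans_smooth j i l k).
  by apply: image_subset => x [xj /Ui].
Qed.

Lemma near_cinv i x (P : set M) : cdom i x -> (\forall y \near x, P y) ->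
  \forall z \near cmap i x, P (cinv i z).
Proof.
move=> xi Px; apply: (@cinv_continuous R M i (cmap i x)); first by exists x.
by rewrite cmapK.
Qed.

Lemma diff_near i x (f g : M -> R) : cdom i x -> (\forall y \near x, f y = g y) ->
  differentiable (f \o cinv i) (cmap i x) ->
  differentiable (g \o cinv i) (cmap i x) /\
  'd (g \o cinv i) (cmap i x) = 'd (f \o cinv i) (cmap i x) :> (_ -> _).
Proof. by move=> xi fg; apply: near_eq_diff; exact: near_cinv fg. Qed.

Lemma diff_partial n (f : 'rV[R]_n -> R) (z w : 'rV[R]_n) :
  'd f z w = \sum_j w 0 j * 'd f z (delta_mx 0 j).
Proof.
by rewrite {1}(row_sum_delta w) linear_sum; apply: eq_bigr => j _; rewrite linearZ.
Qed.

(** The chain rule for the transition map from [j] to [i]; the factorization holds only near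
    [cmap j x], which suffices for derivatives. *)
Lemma diff_chart i j x U (f : M -> R) w : open U -> U x -> cdom i x -> cdom j x ->
  smooth_on M U f -> 'd (f \o cinv j) (cmap j x) w =
    'd (f \o cinv i) (cmap i x) ('d (cmap i \o cinv j) (cmap j x) w).
Proof.
move=> Uo Ux xi xj fs.
have nb : \forall z \near cmap j x, (f \o cinv i) ((cmap i \o cinv j) z) = (f \o cinv j) z.
  apply: filterS (near_cinv (P := cdom i) xj _).
    by move=> z /= zi; rewrite cmapK.
  by apply: open_nbhs_nbhs; split => //; exact: cdom_open.
have [dg _] := @diff_row R _ _ (cmap i \o cinv j) (cmap j x)
  (fun l => smooth_on_diff (cmap_coord_smooth i l) xj xi).
have zE : (cmap i \o cinv j) (cmap j x) = cmap i x by congr (cmap i _); exact: cmapK.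
have df : differentiable (f \o cinv i) ((cmap i \o cinv j) (cmap j x)).
  by rewrite zE; exact: smooth_on_diff fs xi Ux.
have [_ E1] := @near_eq_diff R _ ((f \o cinv i) \o (cmap i \o cinv j)) _ _ nb
  (differentiable_comp dg df).
apply: (etrans (congr1 (fun h => h w) E1)).
apply: (etrans (congr1 (fun h => h w) (diff_comp dg df))).
exact: (congr1 (fun z => 'd (f \o cinv i) z ('d (cmap i \o cinv j) (cmap j x) w)) zE).
Qed.

Lemma smooth_fun_diff (f : smooth_fun M) i x : cdom i x ->
  differentiable (f \o cinv i) (cmap i x).
Proof. by move=> xi; exact: smooth_on_diff (smooth_valP f) xi _. Qed.

Lemma tangent_at_chart i x (v : smooth_fun M -> R) : tangent_at x v -> cdom i x ->
  exists w, forall f : smooth_fun M, v f = 'd (f \o cinv i) (cmap i x) w.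
Proof.
move=> [j [w xj vE]] xi; exists ('d (cmap i \o cinv j) (cmap j x) w) => f.
by rewrite vE; apply: (@diff_chart i j x setT) => //; [exact: openT|exact: smooth_valP].
Qed.

Lemma tangent_at0 x : tangent_at x (fun=> 0 : R).
Proof.
by have [i xi] := cdom_cover x; exists i; exists 0 => // f; rewrite linear0.
Qed.

Lemma tangent_atZ x c (v : smooth_fun M -> R) : tangent_at x v ->
  tangent_at x (fun f => c * v f).
Proof.
by move=> [i [w xi vE]]; exists i; exists (c *: w) => // f; rewrite linearZ vE.
Qed.

Lemma tangent_atD x (v w : smooth_fun M -> R) : tangent_at x v -> tangent_at x w ->
  tangent_at x (fun f => v f + w f).
Proof.
move=> [i [v' xi vE]] /tangent_at_chart/(_ xi)[w' wE].
by exists i; exists (v' + w') => // f; rewrite linearD vE wE.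
Qed.

(** * Cutoffs, globally defined coordinates, and commutators of vector fields *)

Definition mul_fun (f g : smooth_fun M) : smooth_fun M :=
  SmoothFun (smooth_onM openT (smooth_valP f) (smooth_valP g)).

Definition add_fun (f g : smooth_fun M) : smooth_fun M :=
  SmoothFun (smooth_onD openT (smooth_valP f) (smooth_valP g)).

Definition cst_fun (c : R) : smooth_fun M := SmoothFun (@smooth_on_cst R M setT c).

Definition sub_fun (f g : smooth_fun M) : smooth_fun M :=
  add_fun f (mul_fun (cst_fun (-1)) g).

Lemma mul_funE f g x : mul_fun f g x = f x * g x.
Proof. by []. Qed.

Lemma sub_funE f g x : sub_fun f g x = f x - g x.
Proof. by rewrite /= mulN1r. Qed.

(** The closed set [K] contains the support of [chi]. Thus [U] and the complement of [K] form an
    open cover, and a product of [chi] with data smooth on [U] extends smoothly by zero. *)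
Definition cutoff U x W (chi : smooth_fun M) :=
  [/\ open W, W x, W `<=` U, forall y, W y -> chi y = 1 &
    exists K, [/\ closed K, K `<=` U & forall y, ~ K y -> chi y = 0]].

(** A bump function of the model space is transported by a chart and extended by zero. *)
Lemma cutoff_exists U x : open U -> U x -> exists W chi, cutoff U x W chi.
Proof.
move=> Uo Ux; have [i xi] := cdom_cover x.
have Vo := cimgI_open (i := i) Uo.
have : nbhs (cmap i x) (cmap i @` (cdom i `&` U)).
  by apply: open_nbhs_nbhs; split => //; exists x.
move=> /nbhs_ballP[r /= r0 rU].
(* The bump is 1 up to distance [r / 3] and vanishes from [2 * (r / 3)] on, so the closed box [C]
   that contains its support still lies in the ball of radius [r]. *)
have r3 : 0 < r / 3 by rewrite divr_gt0.
have [B [Bs B1 B0]] := bump_rV (cmap i x) r3.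
pose C := [set z : 'rV[R]_(mdim M) | forall j,
  `[cmap i x 0 j - 2 * (r / 3), cmap i x 0 j + 2 * (r / 3)]%classic (z 0 j)].
have CE z : C z <-> forall j, `|z 0 j - cmap i x 0 j| <= 2 * (r / 3).
  by split=> h j; move: (h j); rewrite /= in_itv /= ler_distl.
have CV : C `<=` cmap i @` (cdom i `&` U).
  move=> z /CE zC; apply: rU; split => // a j; rewrite (ord1 a).
  rewrite /ball /= distrC; apply: le_lt_trans (zC j) _.
  lra.
have Cc : compact C.
  apply: (@rV_compact _ _ (fun j =>
    `[cmap i x 0 j - 2 * (r / 3), cmap i x 0 j + 2 * (r / 3)]%classic)) => j.
  exact: segment_compact.
have KU : cinv i @` C `<=` cdom i `&` U.
  by move=> _ [z /CV[y [yi Uy] <-] <-]; rewrite cmapK.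
(* The Hausdorff property enters here: the image of the compact box is compact, hence closed in [M],
   and not merely closed in the chart domain. *)
have Kc : closed (cinv i @` C).
  apply: compact_closed; first exact: mhausdorff.
  apply: continuous_compact Cc; apply: continuous_in_subspaceT => z.
  rewrite inE => /CV[y [yi Uy] yz].
  by apply: cinv_continuous; exists y.
pose chi y := if `[< cdom i y >] then B (cmap i y) else 0.
have chi0 y : ~ (cinv i @` C) y -> chi y = 0.
  rewrite /chi; case: asboolP => // yi yK.
  have /existsNP[j yj] : ~ forall j, `|cmap i y 0 j - cmap i x 0 j| <= 2 * (r / 3).
    by move=> /CE Cy; apply: yK; exists (cmap i y); rewrite ?cmapK.
  by apply: (B0 _ j); rewrite ltW// ltNge; exact/negP.
have chis : smooth_on M setT chi.
  apply: smooth_on_local => y _; case: (pselect (cdom i y)) => yi.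
    exists (cdom i); split => //; first exact: cdom_open.
    apply: (smooth_on_chart (i := i)) => // [|k]; first exact: cdom_open.
    apply: (@Ck_ext _ _ k _ B); first exact: cimg_open.
      by move=> _ [w wi <-]; rewrite /= cmapK// /chi asboolT.
    exact: Ck_sub (Bs k).
  exists (~` (cinv i @` C)); split.
  - exact: closed_openC.
  - by move=> /KU[].
  - by apply: smooth_on_eq0; [exact: closed_openC|exact: chi0].
exists ((cdom i `&` U) `&` (cmap i @^-1` (ball (cmap i x) (r / 3)))).
exists (SmoothFun chis); split.
- rewrite openE => y [[yi Uy] yr].
  have h1 : nbhs y (cdom i `&` U).
    by apply: open_nbhs_nbhs; split => //; apply: openI => //; exact: cdom_open.
  have h2 : nbhs y (cmap i @^-1` (ball (cmap i x) (r / 3))).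
    apply: (cmap_continuous yi).
    by apply: open_nbhs_nbhs; split => //; exact: ball_open.
  exact: filterI.
- by split=> //; exact: ballxx.
- by move=> y [[]].
- move=> y [[yi Uy] [_ yr]]; rewrite /= /chi asboolT//; apply: B1 => j.
  by move: (yr 0 j); rewrite /ball /= distrC => /ltW.
- by exists (cinv i @` C); split => // y /KU[].
Qed.

Lemma cutoff_smooth U x W chi (f : M -> R) : cutoff U x W chi ->
  smooth_on M U f -> open U -> smooth_on M setT (chi \* f).
Proof.
move=> [_ _ _ _ [K [Kc KU chi0]]] fs Uo; apply: smooth_on_local => y _.
case: (pselect (U y)) => Uy.
  exists U; split => //; apply: smooth_onM => //.
  exact: smooth_on_sub Uo _ (smooth_valP chi).
exists (~` K); split; [exact: closed_openC|by move=> /KU|].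
apply: smooth_on_eq0; first exact: closed_openC.
by move=> w /chi0 h; rewrite /= h mul0r.
Qed.

Definition cutoff_fun U x W chi (f : M -> R) (cut : cutoff U x W chi)
    (fs : smooth_on M U f) (Uo : open U) : smooth_fun M :=
  SmoothFun (cutoff_smooth cut fs Uo).

Lemma cutoff_funE U x W chi (f : M -> R) (cut : cutoff U x W chi)
    (fs : smooth_on M U f) (Uo : open U) y : W y -> cutoff_fun cut fs Uo y = f y.
Proof. by have [_ _ _ chi1 _] := cut => Wy; rewrite /= chi1// mul1r. Qed.

(** Vector fields act on global functions only, so the chart coordinates are replaced by global
    functions that agree with them on [W]. *)
Definition coordinates i W (y : 'I_(mdim M) -> smooth_fun M) :=
  [/\ open W, W `<=` cdom i & forall m x, W x -> y m x = cmap i x 0 m].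

Lemma cutoff_coordinates i U x W chi : open U -> U `<=` cdom i ->
  cutoff U x W chi -> exists y, coordinates i W y.
Proof.
move=> Uo Ui cut.
exists (fun m => cutoff_fun cut (smooth_on_sub Uo Ui (cmap_coord_smooth i m)) Uo).
have [Wo _ WU _ _] := cut.
by split => // [z /WU/Ui //|m z Wz]; rewrite cutoff_funE.
Qed.

Lemma coordinates_diff i W y x w m : coordinates i W y -> W x ->
  'd (y m \o cinv i) (cmap i x) w = w 0 m.
Proof.
move=> [Wo Wi yE] Wx; have xi := Wi _ Wx.
have nb : \forall z \near cmap i x, (z : 'rV[R]_(mdim M)) 0 m = (y m \o cinv i) z.
  have h1 : nbhs (cmap i x) (cmap i @` (cdom i `&` W)).
    by apply: open_nbhs_nbhs; split; [exact: cimgI_open|exists x].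
  by apply: filterS h1 => _ [z [zi Wz] <-]; rewrite /= cmapK// yE.
have dc : differentiable (fun z : 'rV[R]_(mdim M) => z 0 m) (cmap i x).
  exact: differentiable_coord.
have [_ ->] := near_eq_diff nb dc.
have [_ <-] := @diff_row R _ _ id (cmap i x) (fun j => differentiable_coord _ _ _).
by rewrite (@diff_val _ _ _ _ _ _ _ (is_diff_id _)).
Qed.

Lemma tangent_at_coordinates i W y x v (f : smooth_fun M) :
  coordinates i W y -> W x -> tangent_at x v ->
  v f = \sum_m v (y m) * 'd (f \o cinv i) (cmap i x) (delta_mx 0 m).
Proof.
move=> coord Wx; have [_ Wi _] := coord.
move=> /tangent_at_chart/(_ (Wi _ Wx))[w vE].
rewrite vE diff_partial; apply: eq_bigr => m _; congr (_ * _).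
by rewrite vE (coordinates_diff _ _ coord Wx).
Qed.

Lemma diff_sum_mul (V : normedModType R) (I : Type) (r : seq I)
    (p q : I -> V -> R) z v :
  (forall j, differentiable (p j) z) -> (forall j, differentiable (q j) z) ->
  differentiable (fun z => \sum_(j <- r) p j z * q j z) z /\
  'd (fun z => \sum_(j <- r) p j z * q j z) z v =
    \sum_(j <- r) ('d (p j) z v * q j z + p j z * 'd (q j) z v).
Proof.
move=> pd qd; elim: r => [|j r [IH1 IH2]].
  rewrite (_ : (fun z => _) = cst 0); last by apply/funext => y; rewrite big_nil.
  by split; [exact: differentiable_cst|rewrite big_nil diff_cst].
rewrite (_ : (fun z => _) =
  (p j * q j) + (fun z => \sum_(j <- r) p j z * q j z)); last first.
  by apply/funext => y; rewrite big_cons.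
have dm : differentiable (p j * q j) z by exact: differentiableM.
split; first exact: differentiableD.
have /(congr1 (@^~ v)) E1 := diffD dm IH1.
have /(congr1 (@^~ v)) E2 := diffM (pd j) (qd j).
rewrite big_cons -IH2; apply: (etrans E1); congr (_ + _).
transitivity (p j z * 'd (q j) z v + q j z * 'd (p j) z v); first exact: E2.
have swap (a b c d : R) : a * b + c * d = d * c + a * b by rewrite addrC (mulrC c).
exact: swap.
Qed.

Definition partial i (m : 'I_(mdim M)) (f : M -> R) (z : 'rV[R]_(mdim M)) : R :=
  'd (f \o cinv i) z (delta_mx 0 m).

(** Near [x] the function [V' f] is the sum of the [V' (y m)] times the partial derivatives of [f];
    differentiating this along [V] with the Leibniz rule separates a first-order part from a
    second-order one. *)
Lemma vector_field_comp i W y V V' x (f : smooth_fun M) :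
  coordinates i W y -> W x -> vector_field V -> vector_field V' ->
  V (V' f) x = \sum_m (V (V' (y m)) x * partial i m f (cmap i x) +
     \sum_n V (y n) x * V' (y m) x * 'd (partial i m f) (cmap i x) (delta_mx 0 n)).
Proof.
move=> coord Wx Vv V'v; have [Wo Wi yE] := coord; have xi := Wi _ Wx.
have [w wE] := tangent_at_chart (Vv x) xi.
rewrite wE.
have nb : \forall z \near cmap i x,
    \sum_m (V' (y m) \o cinv i) z * partial i m f z = (V' f \o cinv i) z.
  have h1 : nbhs (cmap i x) (cmap i @` (cdom i `&` W)).
    by apply: open_nbhs_nbhs; split; [exact: cimgI_open|exists x].
  apply: filterS h1 => _ [u [ui Wu] <-]; rewrite /= cmapK//.
  by rewrite (tangent_at_coordinates f coord Wu (V'v u)).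
have dF m : differentiable (partial i m f) (cmap i x).
  have H : Ck 1 (cmap i @` (cdom i `&` setT)) (partial i m f).
    by have [_] := smooth_valP f i 2%N; exact.
  by apply: (Ck_differentiable H); exists x.
have [d1 d2] := diff_sum_mul (index_enum 'I_(mdim M)) w
  (fun m => smooth_fun_diff (V' (y m)) xi) dF.
have [_ E] := near_eq_diff nb d1.
apply: (etrans (congr1 (fun h => h w) E)); apply: (etrans d2).
apply: eq_bigr => m _; rewrite -wE; congr (_ + _).
rewrite diff_partial mulr_sumr; apply: eq_bigr => n _.
rewrite mulrA; congr (_ * _); rewrite /= cmapK// mulrC; congr (_ * _).
by rewrite wE (coordinates_diff _ _ coord Wx).
Qed.

(** The candidate tangent vector has as components the values of the commutator on the coordinate
    functions; it remains to see that the second-order parts cancel. *)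
Lemma vector_field_commutator V V' : vector_field V -> vector_field V' ->
  vector_field (fun f => sub_fun (V (V' f)) (V' (V f))).
Proof.
move=> Vv V'v x; have [i xi] := cdom_cover x.
have [W [chi cut]] := cutoff_exists (cdom_open i) xi.
have [y coord] := cutoff_coordinates (cdom_open i) (@subset_refl _ _) cut.
have [_ Wx _ _ _] := cut.
exists i.
exists (\sum_m (sub_fun (V (V' (y m))) (V' (V (y m))) x *: delta_mx 0 m)) => // f.
rewrite sub_funE (vector_field_comp f coord Wx Vv V'v).
rewrite (vector_field_comp f coord Wx V'v Vv) [RHS]linear_sum.
rewrite !big_split /= opprD addrACA -sumrB.
(* Exchanging the two summation indices in one second-order part matches its coefficients with those
   of the other, leaving differences of mixed partial derivatives, which vanish by [diff_sym]. *)
rewrite [X in _ + X](_ : _ = 0) ?addr0; last first.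
  rewrite [X in X - _]exchange_big /= -sumrB big1// => n _.
  rewrite -sumrB big1// => m _; rewrite (mulrC (V' (y m) x)) -mulrBr.
  apply/eqP; rewrite mulf_eq0 subr_eq0; apply/orP; right; apply/eqP.
  have fs : Ck 2 (cmap i @` (cdom i `&` setT)) (f \o cinv i) by exact: smooth_valP.
  apply: diff_sym fs; first by apply: cimgI_open; exact: openT.
  by exists x.
by apply: eq_bigr => m _; rewrite -mulrBl [RHS]linearZ mulN1r.
Qed.

End ManifoldTheory.

(** * Jets and derivations of a vector bundle *)

(** Derivations are bare functions satisfying the predicate [linear], so compatibility with sums is
    derived directly from that predicate. *)
Lemma linear_prop_sum (R : pzRingType) (V W : lmodType R) (d : V -> W)
    (I : Type) (r : seq I) (u : I -> V) : linear d ->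
  d (\sum_(j <- r) u j) = \sum_(j <- r) d (u j).
Proof.
move=> dl; have d0 : d 0 = 0.
  by have := dl (-1) 0 0; rewrite scaler0 addr0 scaleN1r addNr.
elim: r => [|j r IH]; first by rewrite !big_nil.
by rewrite !big_cons -IH -[u j]scale1r dl !scale1r.
Qed.

Lemma linear_propD (R : pzRingType) (V W : lmodType R) (d : V -> W) u v :
  linear d -> d (u + v) = d u + d v.
Proof. by move=> dl; have := dl 1 u v; rewrite !scale1r. Qed.

Lemma linear_propB (R : pzRingType) (V W : lmodType R) (d : V -> W) u v :
  linear d -> d (u - v) = d u - d v.
Proof. by move=> dl; have := dl (-1) v u; rewrite !scaleN1r !(addrC (- _)). Qed.

Lemma linear_propZ (R : pzRingType) (V W : lmodType R) (d : V -> W) c u :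
  linear d -> d (c *: u) = c *: d u.
Proof.
move=> dl; have := dl c u 0; rewrite !addr0 => ->.
by have := linear_prop_sum [::] (fun u : V => u) dl; rewrite !big_nil => ->; rewrite addr0.
Qed.

Lemma fct3_pair_lin (R : pzRingType) (A B C : Type) (U V : lmodType R) c
    (f g : (U * (A -> B -> C -> V))%type) x y z :
  (c *: f + g).2 x y z = c *: f.2 x y z + g.2 x y z.
Proof. by []. Qed.

Lemma fct3_pair0 (R : pzRingType) (A B C : Type) (U V : lmodType R) x y z :
  (0 : (U * (A -> B -> C -> V))%type).2 x y z = 0.
Proof. by []. Qed.

Section Bundle.
Context {R : realType} {M : manifold R} (E : vbundle M).
Implicit Types (U W : set M) (i : chart M) (a : triv E) (x : M) (u : Gamma E)
  (f : smooth_fun M).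

Lemma GammaP u u' : (forall x, u x = u' x) -> u = u'.
Proof. by move=> uu'; apply/val_inj/functional_extensionality_dep. Qed.

Lemma secD u u' x : (u + u') x = u x + u' x.
Proof. by []. Qed.

Lemma secN u x : (- u) x = - u x.
Proof. by []. Qed.

Lemma secB u u' x : (u - u') x = u x - u' x.
Proof. by []. Qed.

Lemma secZ c u x : (c *: u) x = c *: u x.
Proof. by []. Qed.

Lemma sec0 x : (0 : Gamma E) x = 0.
Proof. by []. Qed.

Lemma secS f u x : scale_fun f u x = f x *: u x.
Proof. by []. Qed.

Lemma sec_sum (I : Type) (r : seq I) (v : I -> Gamma E) x :
  (\sum_(j <- r) v j) x = \sum_(j <- r) v j x.
Proof.
elim: r => [|j r IH]; first by rewrite !big_nil.
by rewrite !big_cons secD IH.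
Qed.

Lemma mk_sectionE (u : dprod E) x : u \in smooth_section E -> mk_section u x = u x.
Proof. by move=> us; rewrite /mk_section -[section_val _]/(val _) insubdK. Qed.

Definition component a (u : dprod E) k x : R := tmap a x (u x) 0 k.

Lemma component_smooth a u k : smooth_on M (tdom a) (component a u k).
Proof. by have /asboolP := section_valP u; exact. Qed.

Lemma component_lin a c u u' k x :
  component a (c *: u + u') k x = c * component a u k x + component a u' k x.
Proof. by rewrite /component secD secZ linearP !mxE. Qed.

Lemma tmap_inj a x : tdom a x -> injective (tmap a x).
Proof. by move=> xa; exact: bij_inj (tmap_bij xa). Qed.

Definition lift_row a x (r : 'rV[R]_(rank E)) : E x := xget 0 [set e | tmap a x e = r].

Lemma lift_rowK a x r : tdom a x -> tmap a x (lift_row a x r) = r.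
Proof.
move=> /tmap_bij[g _ gK]; rewrite /lift_row.
by case: xgetP => [y _ //|/(_ (g r))]; rewrite /= gK.
Qed.

Lemma component_change a b (u : dprod E) k x : tdom a x -> tdom b x ->
  component b u k x = \sum_j component a u j x * ttrans a b x j k.
Proof. by move=> xa xb; rewrite /component (ttransE _ xa xb) mxE. Qed.

Lemma smooth_section_local (u : dprod E) :
  (forall x, exists W (v : Gamma E), [/\ open W, W x & forall y, W y -> u y = v y]) ->
  u \in smooth_section E.
Proof.
move=> loc; apply/asboolP => a k; apply: smooth_on_local => x xa.
have [W [v [Wo Wx uv]]] := loc x; exists (tdom a `&` W).
have To : open (tdom a `&` W) by apply: openI => //; exact: tdom_open.
split => //; apply: (smooth_on_ext (f := component a v k) To).
  by move=> y [_ /uv uy]; rewrite /component uy.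
apply: (smooth_on_sub To _ (component_smooth a v k)).
by move=> y [].
Qed.

(** Over [U] the components in another trivialization [b] come from those in [a] through the
    transition matrix; off the closed set [K] the section is zero. *)
Lemma cutoff_section a U x W chi (u : dprod E) : cutoff U x W chi -> open U ->
  U `<=` tdom a -> (forall k, smooth_on M U (component a u k)) ->
  ((fun y => chi y *: u y) : dprod E) \in smooth_section E.
Proof.
move=> [_ _ _ _ [K [Kc KU chi0]]] Uo Ua us; apply/asboolP => b k.
apply: smooth_on_local => y yb; have bo := tdom_open b.
case: (pselect (U y)) => Uy.
  exists (tdom b `&` U); have To : open (tdom b `&` U) by exact: openI.
  split => //.
  apply: (smooth_on_ext (f := (chi : M -> R) \*
      (fun y => \sum_j component a u j y * ttrans a b y j k)) To).
    move=> z [zb Uz]; rewrite /= linearZ mxE -component_change//; exact: Ua.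
  apply: smooth_onM => //.
    exact: (smooth_on_sub To (@subsetT _ _) (smooth_valP chi)).
  apply: smooth_on_sum => // j.
  apply: (@smooth_onM R M _ (component a u j) (fun y => ttrans a b y j k)) => //.
    by apply: (smooth_on_sub To _ (us j)) => z [].
  by apply: (smooth_on_sub To _ (ttrans_smooth a b j k)) => z [zb /Ua].
have Ko : open (~` K) by exact: closed_openC.
exists (tdom b `&` ~` K); have To : open (tdom b `&` ~` K) by exact: openI.
split => //; first by split => // /KU.
by apply: smooth_on_eq0 => // z [_ /chi0 ->]; rewrite scale0r linear0 mxE.
Qed.

Definition local_frame a W (e : 'I_(rank E) -> Gamma E) :=
  [/\ open W, W `<=` tdom a & forall k x, W x -> tmap a x (e k x) = delta_mx 0 k].

Lemma cutoff_frame a U x W chi : open U -> U `<=` tdom a -> cutoff U x W chi ->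
  exists e, local_frame a W e.
Proof.
move=> Uo Ua cut; have [Wo _ WU chi1 _] := cut.
pose e0 k : dprod E := fun y => lift_row a y (delta_mx 0 k).
have es k : ((fun y => chi y *: e0 k y) : dprod E) \in smooth_section E.
  apply: (cutoff_section cut Uo Ua _) => l.
  apply: (smooth_on_ext (f := cst ((delta_mx 0 k : 'rV[R]_(rank E)) 0 l)) Uo).
    by move=> y /Ua ya; rewrite /component lift_rowK.
  exact: smooth_on_cst.
exists (fun k => Section_ (es k)); split => // [y /WU/Ua //|k y Wy].
by rewrite /= chi1// scale1r lift_rowK//; exact/Ua/WU.
Qed.

Lemma frame_expand a W e x (v : E x) : local_frame a W e -> W x ->
  v = \sum_k tmap a x v 0 k *: e k x.
Proof.
move=> [_ Wa eE] Wx; apply: (tmap_inj (Wa _ Wx)).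
rewrite linear_sum [LHS]row_sum_delta; apply: eq_bigr => k _.
by rewrite linearZ eE.
Qed.

(** * Locality of derivations and their pairing with jets *)

Lemma gauge_at_linear x d : gauge_at (E := E) (x := x) d -> linear d.
Proof. by case. Qed.

(** With [chi] supported where [u] vanishes and equal to 1 near [x], one has [u = (1 - chi) u]. Both
    terms of the Leibniz rule then vanish, the first because [1 - chi] is 0 at [x], the second
    because [u x = 0]. *)
Lemma gauge_at_near0 x d u : gauge_at (x := x) d -> (\forall y \near x, u y = 0) ->
  d u = 0.
Proof.
move=> [dl [v tv dE]] u0.
pose U := ([set y | u y = 0])^°; have Uo : open U by exact: open_interior.
have Ux : U x by []; have U0 : U `<=` [set y | u y = 0] by exact: interior_subset.
have [W [chi [Wo Wx WU chi1 [K [Kc KU chi0]]]]] := cutoff_exists Uo Ux.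
have uE : u = scale_fun (sub_fun (cst_fun 1) chi) u.
  apply: GammaP => y; rewrite /= mulN1r.
  case: (pselect (U y)) => [/U0 /= ->|Uy]; first by rewrite scaler0.
  by rewrite chi0 ?subr0 ?scale1r// => /KU.
by rewrite uE dE (U0 _ Ux) scaler0 addr0 sub_funE chi1// subrr scale0r.
Qed.

Lemma gauge_at_near x d u u' : gauge_at (x := x) d ->
  (\forall y \near x, u y = u' y) -> d u = d u'.
Proof.
move=> gd uu'; apply/eqP; rewrite -subr_eq0 -linear_propB; last exact: gauge_at_linear.
apply/eqP; apply: gauge_at_near0 gd _; apply: filterS uu' => y yE.
by rewrite secB yE subrr.
Qed.

Lemma gauge_at_expand a W e x d v u (c : 'I_(rank E) -> smooth_fun M) :
  local_frame a W e -> W x -> gauge_at (x := x) d ->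
  (forall f u, d (scale_fun f u) = f x *: d u + v f *: u x) ->
  (forall k y, W y -> c k y = component a u k y) ->
  d u = \sum_k (c k x *: d (e k) + v (c k) *: e k x).
Proof.
move=> fr Wx gd dE cE; have [Wo Wa _] := fr.
rewrite (gauge_at_near (u' := \sum_k scale_fun (c k) (e k)) gd).
  rewrite linear_prop_sum; last exact: gauge_at_linear.
  by apply: eq_bigr => k _.
apply: filterS (open_nbhs_nbhs (conj Wo Wx)) => y Wy.
by rewrite sec_sum {1}(frame_expand (u y) fr Wy); apply: eq_bigr => k _; rewrite /= cE.
Qed.

Lemma jet2E i a x u v k : cdom i x -> tdom a x ->
  (jet u x).2 i a v 0 k = 'd (component a u k \o cinv i) (cmap i x) v.
Proof.
move=> xi xa; rewrite /jet /= asboolT//.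
have [_ ->//] := @diff_row R _ _ (fun z => tmap a (cinv i z) (u (cinv i z))) (cmap i x)
  (fun j => smooth_on_diff (component_smooth a u j) xi xa).
Qed.

Lemma jet2_out i a x u v k : ~ (cdom i x /\ tdom a x) -> (jet u x).2 i a v 0 k = 0.
Proof. by move=> xia; rewrite /jet /= asboolF// mxE. Qed.

Lemma jet_space_lin x c (m m' : jet_space E x) i a v k :
  (c *: m + m').2 i a v 0 k = c * m.2 i a v 0 k + m'.2 i a v 0 k.
Proof.
by rewrite (fct3_pair_lin c m m') !mxE.
Qed.

Lemma jet_linear x : linear (fun u => jet u x).
Proof.
move=> c u u'; apply: injective_projections; first by [].
apply/funext => i; apply/funext => a; apply/funext => v; apply/rowP => k.
rewrite (jet_space_lin c (jet u x) (jet u' x)).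
case: (pselect (cdom i x /\ tdom a x)) => [[xi xa]|xia]; last first.
  have out w : (jet w x).2 i a v 0 k = 0 by exact: jet2_out.
  apply: (etrans (out _)); apply: esym.
  apply: (etrans (congr2 (fun p q => c * p + q) (out u) (out u'))).
  by rewrite mulr0 addr0.
apply: (etrans (jet2E _ v k xi xa)); apply: esym.
apply: (etrans (congr2 (fun p q => c * p + q) (jet2E u v k xi xa) (jet2E u' v k xi xa))).
apply: esym.
have cE : component a (c *: u + u') k \o cinv i =
    (c \*: (component a u k \o cinv i)) + (component a u' k \o cinv i).
  by apply/funext => z; exact: component_lin.
have du := smooth_on_diff (component_smooth a u k) xi xa.
have du' := smooth_on_diff (component_smooth a u' k) xi xa.
rewrite cE; apply: (etrans (congr1 (fun h => h v) (diffD (differentiableZ c du) du'))).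
congr (_ + _); exact: (congr1 (fun h => h v) (diffZ c du)).
Qed.

(** By linearity it suffices to treat a section with zero jet at [x]. Expanded in a frame, its
    coefficients vanish at [x] together with their derivatives, hence so does every term of
    [gauge_at_expand]. This makes [jet_pairing] independent of the chosen representative. *)
Lemma gauge_at_jet x d u u' : gauge_at (x := x) d -> jet u x = jet u' x -> d u = d u'.
Proof.
move=> gd uu'; apply/eqP; rewrite -subr_eq0 -linear_propB; last exact: gauge_at_linear.
have : jet (u - u') x = 0.
  by rewrite (linear_propB u u' (@jet_linear x)) uu' subrr.
move: (u - u') => w w0; apply/eqP; have [dl [v tv dE]] := gd.
have [a xa] := tdom_cover E x; have ao := tdom_open a.
have [W [chi cut]] := cutoff_exists ao xa; have [Wo Wx Wa chi1 _] := cut.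
have [e fr] := cutoff_frame ao (@subset_refl _ _) cut.
pose c k := cutoff_fun cut (component_smooth a w k) ao.
have cE k y : W y -> c k y = component a w k y by exact: cutoff_funE.
apply: (etrans (gauge_at_expand (u := w) (v := v) (c := c) fr Wx gd dE cE)).
apply: big1 => k _.
have [i [z xi vE]] := tv.
have wx0 : w x = 0 by exact: (congr1 fst w0).
have ck0 : c k x = 0 by rewrite (cE k x Wx) /component wx0 linear0 mxE.
have nb : \forall y \near x, component a w k y = c k y.
  by apply: filterS (open_nbhs_nbhs (conj Wo Wx)) => y Wy; rewrite cE.
have [_ E1] := diff_near xi nb (smooth_on_diff (component_smooth a w k) xi xa).
have vk0 : v (c k) = 0.
  rewrite vE; apply: (etrans (congr1 (fun h => h z) E1)).
  apply: (etrans (esym (jet2E w z k xi xa))); rewrite w0.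
  by rewrite [LHS](congr1 (fun r : 'rV_(rank E) => r 0 k)
    (@fct3_pair0 R _ _ _ (E x) 'rV[R]_(rank E) i a z)) mxE.
by rewrite ck0 vk0 !scale0r addr0.
Qed.

Lemma jet_pairing_jet x d u : gauge_at (x := x) d -> jet_pairing (jet u x) d = d u.
Proof.
move=> gd; apply: gauge_at_jet gd _; rewrite /jet_pairing.
case: xgetP => [u' _ u'E|no]; first exact: u'E.
case: (no u erefl).
Qed.

Lemma gauge_val_at D x : gauge_section D -> gauge_at (gauge_val (E := E) D x).
Proof.
move=> [Dl [V Vv DE]]; split; first by move=> c u u'; rewrite /gauge_val Dl.
by exists (fun f => V f x) => // f u; rewrite /gauge_val DE.
Qed.

Lemma gauge_section_near D u u' x : gauge_section D -> (\forall y \near x, u y = u' y) ->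
  D u x = D u' x.
Proof. by move=> /(gauge_val_at x)/gauge_at_near; apply. Qed.

Lemma jet_pairing_lin x d c (m m' : jet_space E x) :
  gauge_at d -> jet_at m -> jet_at m' ->
  jet_pairing (c *: m + m') d = c *: jet_pairing m d + jet_pairing m' d.
Proof.
move=> gd [u _ <-] [u' _ <-].
apply: (etrans (congr1 (fun m => jet_pairing m d) (esym (@jet_linear x c u u')))).
apply: (etrans (jet_pairing_jet (c *: u + u') gd)); apply: esym.
apply: (etrans (congr2 (fun p q => c *: p + q)
  (jet_pairing_jet u gd) (jet_pairing_jet u' gd))); apply: esym.
by have [dl _] := gd; exact: dl.
Qed.

Lemma jet_at_lin x c (m m' : jet_space E x) :
  jet_at m -> jet_at m' -> jet_at (c *: m + m').
Proof. by move=> [u _ <-] [u' _ <-]; exists (c *: u + u'); [|exact: jet_linear]. Qed.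

(** In a frame [e] and coordinates [y], a jet is a combination of the jets of the [e k] and of the
    tensors of [dy m] with [e k]. Each such tensor is the jet of [y m * e k] minus [y m] times the
    jet of [e k]. The three summands of the index type [I] are the value part and these two
    terms. *)
Lemma jet_section_rep mu x0 : jet_section (E := E) mu ->
  exists (I : finType) (g : I -> smooth_fun M) (u : I -> Gamma E) W,
    [/\ open W, W x0 & forall x d, W x -> gauge_at d ->
      jet_pairing (mu x) d = \sum_j g j x *: d (u j)].
Proof.
move=> [muj mu1 mu2].
have [i xi] := cdom_cover x0; have [a xa] := tdom_cover E x0.
pose U := cdom i `&` tdom a.
have Uo : open U by apply: openI; [exact: cdom_open|exact: tdom_open].
have Ui : U `<=` cdom i by move=> ? [].
have Ua : U `<=` tdom a by move=> ? [].
have [W [chi cut]] := cutoff_exists Uo (conj xi xa); have [Wo Wx WU chi1 _] := cut.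
have [y coord] := cutoff_coordinates Uo Ui cut.
have [e fr] := cutoff_frame Uo Ua cut.
have cs k : smooth_on M U (component a (fun x => (mu x).1) k).
  by apply: (smooth_on_sub Uo Ua); move/asboolP : mu1; exact.
pose C k := cutoff_fun cut (cs k) Uo.
pose P m k := cutoff_fun cut (mu2 i a (delta_mx 0 m) k) Uo.
have CE k z : W z -> C k z = component a (fun x => (mu x).1) k z by exact: cutoff_funE.
have PE m k z : W z -> P m k z = (mu z).2 i a (delta_mx 0 m) 0 k by exact: cutoff_funE.
pose I := ('I_(rank E) + ('I_(mdim M) * 'I_(rank E) + 'I_(mdim M) * 'I_(rank E)))%type.
exists I, (fun j : I => match j with
  | inl k => C k
  | inr (inl mk) => P mk.1 mk.2
  | inr (inr mk) => mul_fun (cst_fun (-1)) (mul_fun (P mk.1 mk.2) (y mk.1)) end).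
exists (fun j : I => match j with
  | inl k => e k
  | inr (inl mk) => scale_fun (y mk.1) (e mk.2)
  | inr (inr mk) => e mk.2 end), W.
(* The representative [s] varies with [x], but only its jet at [x], namely [mu x], enters the
   formula. *)
split=> // x d Wx' gd; have [s _ sE] := muj x.
have [ix ax] := WU _ Wx'.
have [dl [v tv dE]] := gd.
pose S k := cutoff_fun cut (smooth_on_sub Uo Ua (component_smooth a s k)) Uo.
have sE' k z : W z -> S k z = component a s k z by exact: cutoff_funE.
rewrite -sE; apply: (etrans (jet_pairing_jet s gd)).
apply: (etrans (gauge_at_expand (u := s) (v := v) (c := S) fr Wx' gd dE sE')).
pose G mk := P mk.1 mk.2 x *: d (scale_fun (y mk.1) (e mk.2)) +
  mul_fun (cst_fun (-1)) (mul_fun (P mk.1 mk.2) (y mk.1)) x *: d (e mk.2).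
transitivity (\sum_k C k x *: d (e k) + \sum_mk G mk); last first.
  by rewrite big_split !big_sumType.
rewrite big_split; congr (_ + _).
  apply: eq_bigr => k _; congr (_ *: _); rewrite (sE' k x Wx').
  by apply: esym; apply: (etrans (CE k x Wx')); rewrite /component -sE.
(* By the derivation rule, [d (y m * e k) - y m * d (e k)] reduces at [x] to [v (y m) *: e k x]. *)
transitivity (\sum_(mk : 'I_(mdim M) * 'I_(rank E))
    (v (y mk.1) * (mu x).2 i a (delta_mx 0 mk.1) 0 mk.2) *: e mk.2 x); last first.
  apply: eq_bigr => mk _; rewrite /G dE -(PE _ _ x Wx') 2!mul_funE.
  move: (P _ _ x) (d _) (v _) (e _ x) (y _ x) => p de vy ex yx.
  by rewrite [cst_fun _ _]/= mulN1r scalerDr !scalerA addrAC scaleNr subrr add0r mulrC.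
rewrite -(pair_bigA _ (fun m k => (v (y m) * (mu x).2 i a (delta_mx 0 m) 0 k) *: e k x)).
rewrite exchange_big; apply: eq_bigr => k _ /=; rewrite -scaler_suml; congr (_ *: _).
rewrite (tangent_at_coordinates _ coord Wx' tv); apply: eq_bigr => m _; congr (_ * _).
have nb : \forall z \near x, component a s k z = S k z.
  by apply: filterS (open_nbhs_nbhs (conj Wo Wx')) => z Wz; rewrite sE'.
have [_ E1] := diff_near ix nb (smooth_on_diff (component_smooth a s k) ix ax).
by rewrite (congr1 (fun h => h (delta_mx 0 m)) E1) -jet2E// sE.
Qed.

Lemma pairing_smooth mu D : jet_section (E := E) mu -> gauge_section D ->
  ((fun x => jet_pairing (mu x) (gauge_val D x)) : dprod E) \in smooth_section E.
Proof.
move=> muj gD; apply: smooth_section_local => x.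
have [I [g [u [W [Wo Wx rep]]]]] := jet_section_rep x muj.
exists W, (\sum_j scale_fun (g j) (D (u j))); split => // y Wy.
by rewrite (rep y _ Wy (gauge_val_at y gD)) sec_sum.
Qed.

Lemma pairingE mu D x : jet_section (E := E) mu -> gauge_section D ->
  pairing mu D x = jet_pairing (mu x) (gauge_val D x).
Proof. by move=> muj gD; rewrite /pairing mk_sectionE//; exact: pairing_smooth. Qed.

(** In the Leibniz rule for the commutator, the terms [V f *: D' u] and [V' f *: D u] occur in both
    composites and cancel; the symbol is the commutator of the symbols. *)
Lemma commutator_gauge D D' : gauge_section (E := E) D -> gauge_section D' ->
  gauge_section (commutator D D').
Proof.
move=> [Dl [V Vv DE]] [D'l [V' V'v D'E]]; split.
  move=> c u u'; rewrite /commutator D'l Dl [D (_ + _)]Dl D'l.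
  by rewrite scalerBr opprD addrACA.
exists (fun f => sub_fun (V (V' f)) (V' (V f))); first exact: vector_field_commutator.
move=> f u; apply: GammaP => x; rewrite /commutator D'E DE.
rewrite (linear_propD _ _ Dl) (linear_propD _ _ D'l) !DE !D'E.
rewrite secB !secD !secS secB sub_funE scalerBr scalerBl.
have cancel4 (V0 : zmodType) (p q r s p' s' : V0) :
    p + q + (r + s) - (p' + r + (q + s')) = p - p' + (s - s').
  have e1 : p + q + (r + s) = (q + r) + (p + s) by rewrite (addrC p) addrACA.
  have e2 : p' + r + (q + s') = (q + r) + (p' + s').
    by rewrite (addrC p') addrACA (addrC r).
  by rewrite e1 (addrC (q + r)) e2 addrKA opprD addrACA.
exact: cancel4.
Qed.

(** Pairing with the identity returns the value of a jet; the smoothness of the value part of the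
    Lie derivative is obtained this way. *)
Lemma id_gauge : gauge_section (E := E) id.
Proof.
split; first by [].
exists (fun=> cst_fun 0); first by move=> x; exact: tangent_at0.
by move=> f u; apply: GammaP => x; rewrite secD !secS scale0r addr0.
Qed.

End Bundle.

(** * Coordinate derivations and the Lie derivative *)

Lemma dchart_smooth {R : realType} {M : manifold R} (i : chart M) (U : set M)
    (f : M -> R) v : open U -> U `<=` cdom i -> smooth_on M U f ->
  smooth_on M U (fun x => 'd (f \o cinv i) (cmap i x) v).
Proof.
move=> Uo Ui fs; apply: (smooth_on_chart (i := i) Uo Ui) => k.
have UE : cdom i `&` U = U by exact: setIidr.
have fsk : Ck k.+1 (cmap i @` U) (f \o cinv i) by rewrite -UE; exact: fs.
have Vo : open (cmap i @` U) by rewrite -UE; exact: cimgI_open.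
apply: (@Ck_ext _ _ k _ (fun z => 'd (f \o cinv i) z v)); first exact: Vo.
  move=> _ [x /Ui xi <-].
  exact: (congr1 (fun y => 'd (f \o cinv i) (cmap i y) v) (esym (cmapK xi))).
by case: fsk => _; exact.
Qed.

Section GaugeSections.
Context {R : realType} {M : manifold R} (E : vbundle M).
Implicit Types (U W : set M) (i : chart M) (a : triv E) (x : M) (u : Gamma E)
  (f : smooth_fun M).

Lemma prolongation_section u : jet_section (prolongation u).
Proof.
split.
- by move=> x; exists u.
- exact: section_valP u.
- move=> i a v k.
  have Uo : open (cdom i `&` tdom a).
    by apply: openI; [exact: cdom_open|exact: tdom_open].
  have Ui : cdom i `&` tdom a `<=` cdom i by move=> ? [].
  have Ua : cdom i `&` tdom a `<=` tdom a by move=> ? [].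
  have := dchart_smooth v Uo Ui (smooth_on_sub Uo Ua (component_smooth a u k)).
  by apply: (smooth_on_ext Uo) => x [xi xa]; rewrite -(jet2E u v k xi xa).
Qed.

Lemma jet_section_lin f (mu nu : dprod (jet_space E)) :
  jet_section mu -> jet_section nu ->
  jet_section ((fun x => f x *: mu x + nu x) : dprod (jet_space E)).
Proof.
move=> [muj mu1 mu2] [nuj nu1 nu2]; split.
- by move=> x; exact: jet_at_lin.
- have <- : (scale_fun f (Section_ mu1) + Section_ nu1 : dprod E) =
    (fun x => (f x *: mu x + nu x).1) by [].
  exact: section_valP (scale_fun f (Section_ mu1) + Section_ nu1).
- move=> i a v k; have Uo : open (cdom i `&` tdom a).
    by apply: openI; [exact: cdom_open|exact: tdom_open].
  have fs := smooth_onM Uo (smooth_on_sub Uo (@subsetT _ _) (smooth_valP f))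
    (mu2 i a v k).
  apply: (smooth_on_ext Uo _ (smooth_onD Uo fs (nu2 i a v k))) => x _.
  by rewrite (jet_space_lin (f x) (mu x) (nu x)).
Qed.

Lemma gauge_section_lin f D D' : gauge_section (E := E) D -> gauge_section D' ->
  gauge_section (fun u => scale_fun f (D u) + D' u).
Proof.
move=> [Dl [V Vv DE]] [D'l [V' V'v D'E]]; split.
  move=> c u u'; apply: GammaP => x; rewrite Dl D'l !(secD, secS, secZ).
  by rewrite !scalerDr !scalerA (mulrC c) addrACA.
exists (fun g => add_fun (mul_fun f (V g)) (V' g)).
  by move=> x; exact: (tangent_atD (tangent_atZ (f x) (Vv x)) (V'v x)).
move=> g u; apply: GammaP => x; rewrite DE D'E !(secD, secS).
rewrite [add_fun _ _ x]/= scalerDl !scalerDr !scalerA (mulrC (f x) (g x)).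
by rewrite addrACA.
Qed.

Lemma zero_gauge : gauge_section (fun _ : Gamma E => 0).
Proof.
split; first by move=> c u u'; rewrite scaler0 addr0.
exists (fun=> cst_fun 0); first by move=> x; exact: tangent_at0.
by move=> f u; apply: GammaP => x; rewrite secD !secS sec0 scaler0 scale0r addr0.
Qed.

(** The componentwise derivative in the direction [v], multiplied by a cutoff, is a global
    derivation. Pairing a jet with it returns a first-order coordinate of that jet over [W], so it
    serves to test smoothness. *)
Lemma coordinate_gauge i a v x0 : cdom i x0 -> tdom a x0 ->
  exists (D : Gamma E -> Gamma E) W, [/\ gauge_section D, open W, W x0,
    W `<=` cdom i `&` tdom a & forall u x k, W x ->
      component a (D u) k x = 'd (component a u k \o cinv i) (cmap i x) v].
Proof.
move=> xi xa; pose U := cdom i `&` tdom a.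
have Uo : open U by apply: openI; [exact: cdom_open|exact: tdom_open].
have Ui : U `<=` cdom i by move=> ? [].
have Ua : U `<=` tdom a by move=> ? [].
have [W [chi cut]] := cutoff_exists Uo (conj xi xa).
have [Wo Wx WU chi1 [K [Kc KU chi0]]] := cut.
have chiU x : ~ U x -> chi x = 0 by move=> Ux; apply: chi0 => /KU.
pose dv u k x : R := 'd (component a u k \o cinv i) (cmap i x) v.
pose D0 u : dprod E := fun x => lift_row a x (\row_k dv u k x).
have D0E u k x : U x -> component a (D0 u) k x = dv u k x.
  by move=> /Ua xa'; rewrite /component lift_rowK// mxE.
have D0s u k : smooth_on M U (component a (D0 u) k).
  have ds := dchart_smooth v Uo Ui (smooth_on_sub Uo Ua (component_smooth a u k)).
  by apply: (smooth_on_ext Uo _ ds) => x Ux; rewrite D0E.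
pose D u := Section_ (cutoff_section cut Uo Ua (D0s u)).
have DE u x : D u x = chi x *: D0 u x by [].
have Ds f := dchart_smooth v Uo Ui (smooth_on_sub Uo (@subsetT _ _) (smooth_valP f)).
pose V f := SmoothFun (cutoff_smooth cut (Ds f) Uo).
have VE f x : V f x = chi x * 'd (f \o cinv i) (cmap i x) v by [].
have du u k x : U x -> differentiable (component a u k \o cinv i) (cmap i x).
  by move=> [xi' xa']; exact: smooth_on_diff (component_smooth a u k) xi' xa'.
(* Identities for [D] are checked componentwise on [U]; elsewhere [D u] is zero. *)
have DP u x (e : E x) : (U x -> forall k, tmap a x e 0 k = chi x * dv u k x) ->
    (~ U x -> e = 0) -> D u x = e.
  move=> h1 h2; case: (pselect (U x)) => Ux.
    apply: (tmap_inj (Ua _ Ux)); apply/rowP => k; rewrite h1//.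
    by rewrite DE linearZ mxE; congr (_ * _); exact: D0E.
  by rewrite (h2 Ux) DE chiU// scale0r.
have DO u x : ~ U x -> D u x = 0 by move=> Ux; rewrite DE chiU// scale0r.
have DU u x k : U x -> tmap a x (D u x) 0 k = chi x * dv u k x.
  by move=> Ux; rewrite DE linearZ mxE; congr (_ * _); exact: D0E.
exists D, W; split => //; last first.
  by move=> u x k Wx'; rewrite /component (DU u x k (WU _ Wx')) chi1// mul1r.
split.
  move=> c u u'; apply: GammaP => x; apply: DP => Ux; last first.
    by rewrite secD secZ !DO// scaler0 addr0.
  move=> k; transitivity (c * tmap a x (D u x) 0 k + tmap a x (D u' x) 0 k).
    by rewrite secD secZ linearP !mxE.
  apply: (etrans (congr2 (fun p q => c * p + q) (DU u x k Ux) (DU u' x k Ux))).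
  have -> : dv (c *: u + u') k x = c * dv u k x + dv u' k x.
    have cE : component a (c *: u + u') k \o cinv i =
        (c \*: (component a u k \o cinv i)) + (component a u' k \o cinv i).
      by apply/funext => z; exact: component_lin.
    rewrite /dv cE.
    apply: (etrans (congr1 (fun h => h v)
      (diffD (differentiableZ c (du u k x Ux)) (du u' k x Ux)))).
    congr (_ + _); exact: (congr1 (fun h => h v) (diffZ c (du u k x Ux))).
  by rewrite mulrDr !mulrA (mulrC c).
exists V.
  move=> x; case: (pselect (U x)) => Ux.
    by exists i; exists (chi x *: v); [exact: Ui|move=> f; rewrite VE linearZ].
  have [j xj] := cdom_cover x; exists j; exists 0 => // f.
  by rewrite VE chiU// mul0r linear0.
move=> f u; apply: GammaP => x; apply: DP => Ux; last first.
  by rewrite secD !secS VE !DO// chiU// mul0r scaler0 scale0r addr0.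
move=> k.
transitivity (f x * tmap a x (D u x) 0 k + V f x * tmap a x (u x) 0 k).
  by rewrite secD !secS linearD !linearZ !mxE.
apply: (etrans (congr1 (fun p => f x * p + _) (DU u x k Ux))); rewrite VE.
have cE : component a (scale_fun f u) k \o cinv i =
    (f \o cinv i) * (component a u k \o cinv i).
  by apply/funext => z; rewrite /component /= linearZ mxE.
have df : differentiable (f \o cinv i) (cmap i x) by exact: smooth_fun_diff (Ui _ Ux).
have dE : dv (scale_fun f u) k x = f x * dv u k x +
    component a u k x * 'd (f \o cinv i) (cmap i x) v.
  have zf : (f \o cinv i) (cmap i x) = f x := congr1 f (cmapK (Ui _ Ux)).
  have zu : (component a u k \o cinv i) (cmap i x) = component a u k x :=
    congr1 (component a u k) (cmapK (Ui _ Ux)).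
  rewrite -zf -zu /dv cE; exact: (congr1 (fun h => h v) (diffM df (du u k x Ux))).
apply: (etrans _ (congr1 (fun p => chi x * p) (esym dE))).
have leibniz (p c q r t : R) : p * (c * q) + c * r * t = c * (p * q + t * r) by ring.
exact: leibniz.
Qed.

(** The jet is first built at each point from a local representation of [mu]; smoothness of the
    resulting family comes afterwards, from its pairings, which are smooth sections by the defining
    formula. *)
Lemma lie_derivative_exists D (mu : dprod (jet_space E)) :
  gauge_section D -> jet_section mu ->
  exists mu', jet_section mu' /\ forall D', gauge_section D' ->
    pairing mu' D' = D (pairing mu D') - pairing mu (commutator D D').
Proof.
move=> gD muj.
have key x : exists m : jet_space E x, jet_at m /\ forall D', gauge_section D' ->
    jet_pairing m (gauge_val D' x) =
    (D (pairing mu D') - pairing mu (commutator D D')) x.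
  have [I [g [u [W [Wo Wx rep]]]]] := jet_section_rep x muj.
  have [Dl [V Vv DE]] := gD.
  (* The coefficients are frozen at [x]: as only the jet of [s] at that point matters, constants may
     replace the functions [g j] and [V (g j)]. *)
  pose s := \sum_j (g j x *: D (u j) + V (g j) x *: u j).
  exists (jet s x); split; first by exists s.
  move=> D' gD'; apply: (etrans (jet_pairing_jet s (gauge_val_at x gD'))).
  have [D'l _] := gD'.
  have Dp : D (pairing mu D') x =
      \sum_j (g j x *: D (D' (u j)) x + V (g j) x *: D' (u j) x).
    have nb : \forall y \near x, pairing mu D' y = (\sum_j scale_fun (g j) (D' (u j))) y.
      apply: filterS (open_nbhs_nbhs (conj Wo Wx)) => y Wy.
      by rewrite (pairingE y muj gD') (rep y _ Wy (gauge_val_at y gD')) sec_sum.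
    rewrite (gauge_section_near gD nb) (linear_prop_sum _ _ Dl) sec_sum.
    by apply: eq_bigr => j _; rewrite DE secD !secS.
  rewrite secB Dp (pairingE x muj (commutator_gauge gD gD')).
  rewrite (rep x _ Wx (gauge_val_at x (commutator_gauge gD gD'))).
  rewrite /gauge_val /s (linear_prop_sum _ _ D'l) sec_sum -sumrB.
  apply: eq_bigr => j _; rewrite (linear_propD _ _ D'l) !(linear_propZ _ _ D'l).
  rewrite secD !secZ /commutator secB scalerBr.
  (* Here [p], [q] and [r] stand for [g D' (D u)], [(V g) D' u] and [g D (D' u)] at [x], so that
     [r - p] is the commutator term. *)
  have cancel (A : zmodType) (p q r : A) : p + q = r + q - (r - p).
    by rewrite opprB (addrC r) -addrA (addrC r) subrK addrC.
  exact: cancel.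
pose mu' : dprod (jet_space E) := fun x => sval (cid (key x)).
have mu'j x : jet_at (mu' x) by have [] := svalP (cid (key x)).
have mu'E x D' : gauge_section D' -> jet_pairing (mu' x) (gauge_val D' x) =
    (D (pairing mu D') - pairing mu (commutator D D')) x.
  by have [_] := svalP (cid (key x)); exact.
have mu's : jet_section mu'.
  split => // [|i a v k].
    (* The value part is the pairing with the identity. *)
    have -> : (fun x => (mu' x).1) =
        (D (pairing mu id) - pairing mu (commutator D id) : dprod E).
      apply: functional_extensionality_dep => x.
      rewrite -(mu'E x id (id_gauge E)); have [u _ uE] := mu'j x.
      rewrite -uE; apply: esym.
      exact: (jet_pairing_jet u (gauge_val_at x (id_gauge E))).
    exact: section_valP (D (pairing mu id) - pairing mu (commutator D id)).
  (* The derivative part is, near [x0], a component of the pairing with a coordinate derivation. *)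
  apply: smooth_on_local => x0 [xi xa].
  have [D' [W [gD' Wo Wx WU D'E]]] := coordinate_gauge v xi xa.
  exists W; split => //.
  have Wa : W `<=` tdom a by move=> ? /WU[].
  have cs := component_smooth a (D (pairing mu D') - pairing mu (commutator D D')) k.
  apply: (smooth_on_ext Wo _ (smooth_on_sub Wo Wa cs)) => x Wx'.
  have [xi' xa'] := WU _ Wx'.
  have [u _ uE] := mu'j x.
  rewrite /component -(mu'E x D' gD') -uE.
  have -> : jet_pairing (jet u x) (gauge_val D' x) = D' u x.
    exact: (jet_pairing_jet u (gauge_val_at x gD')).
  by rewrite -[LHS]/(component a (D' u) k x) D'E// (jet2E u v k xi' xa').
exists mu'; split => // D' gD'; apply: GammaP => x.
by rewrite (pairingE x mu's gD') mu'E.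
Qed.

Lemma lie_derivativeP D (mu : dprod (jet_space E)) :
  gauge_section D -> jet_section mu ->
  jet_section (lie_derivative D mu) /\ forall D', gauge_section D' ->
    pairing (lie_derivative D mu) D' =
      D (pairing mu D') - pairing mu (commutator D D').
Proof.
move=> gD muj; have [mu' mu'P] := lie_derivative_exists gD muj.
by rewrite /lie_derivative; case: xgetP => [nu _ //|/(_ mu')].
Qed.

End GaugeSections.

(** * The omni-Lie bracket *)

Section OmniLie.
Context {R : realType} {M : manifold R} (E : vbundle M).
Implicit Types (U W : set M) (x : M) (u : Gamma E) (f : smooth_fun M)
  (mu nu : dprod (jet_space E)) (D : Gamma E -> Gamma E) (X Y l : omni E).

Lemma jet_sectionD mu nu : jet_section mu -> jet_section nu -> jet_section (mu + nu).
Proof.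
move=> muj nuj.
suff -> : mu + nu = (fun x => cst_fun 1 x *: mu x + nu x) by exact: jet_section_lin.
by apply: functional_extensionality_dep => x; rewrite scale1r.
Qed.

Lemma jet_sectionB mu nu : jet_section mu -> jet_section nu -> jet_section (mu - nu).
Proof.
move=> muj nuj.
suff -> : mu - nu = (fun x => cst_fun (-1) x *: nu x + mu x) by exact: jet_section_lin.
by apply: functional_extensionality_dep => x; rewrite scaleN1r addrC.
Qed.

Lemma omni_bracket_section X Y : omni_section X -> omni_section Y ->
  omni_section (omni_bracket X Y).
Proof.
move=> [X1 X2] [Y1 Y2]; split; first exact: commutator_gauge.
apply: jet_sectionD; last exact: prolongation_section.
apply: jet_sectionB; [exact: (lie_derivativeP X1 Y2).1|exact: (lie_derivativeP Y1 X2).1].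
Qed.

Lemma omni_val_at X x : omni_section X -> omni_at (omni_val X x).
Proof. by move=> [X1 [X2 _ _]]; split; [exact: gauge_val_at|exact: X2]. Qed.

Lemma pairingD mu nu D : jet_section mu -> jet_section nu -> gauge_section D ->
  pairing (mu + nu) D = pairing mu D + pairing nu D.
Proof.
move=> muj nuj gD; have mnj := jet_sectionD muj nuj; apply: GammaP => x.
have [m _ _] := muj; have [n _ _] := nuj.
have := jet_pairing_lin 1 (gauge_val_at x gD) (m x) (n x); rewrite !scale1r => mnE.
rewrite (pairingE x mnj gD) secD (pairingE x muj gD) (pairingE x nuj gD).
exact: mnE.
Qed.

Lemma pairingB mu nu D : jet_section mu -> jet_section nu -> gauge_section D ->
  pairing (mu - nu) D = pairing mu D - pairing nu D.
Proof.
move=> muj nuj gD; rewrite -[in RHS](subrK nu mu).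
by rewrite (pairingD (jet_sectionB muj nuj) nuj gD) addrK.
Qed.

Lemma pairing_prolongation u D : gauge_section D -> pairing (prolongation u) D = D u.
Proof.
move=> gD; apply: GammaP => x; rewrite (pairingE x (prolongation_section u) gD).
exact: (jet_pairing_jet u (gauge_val_at x gD)).
Qed.

Lemma pairing_commutator mu D D' : jet_section mu -> gauge_section D ->
  gauge_section D' -> pairing mu (commutator D D') = - pairing mu (commutator D' D).
Proof.
move=> muj gD gD'; apply: GammaP => x; rewrite secN.
have gC := commutator_gauge gD gD'; have gC' := commutator_gauge gD' gD.
rewrite (pairingE x muj gC) (pairingE x muj gC'); have [m _ _] := muj.
have [u _ <-] := m x.
apply: (etrans (jet_pairing_jet u (gauge_val_at x gC))).
apply: esym; apply: (etrans (congr1 -%R (jet_pairing_jet u (gauge_val_at x gC')))).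
by rewrite /gauge_val /commutator !secB opprB.
Qed.

Lemma pairing_bracket X Y D : omni_section X -> omni_section Y -> gauge_section D ->
  pairing (omni_bracket X Y).2 D =
    X.1 (pairing Y.2 D) - pairing Y.2 (commutator X.1 D)
    - (Y.1 (pairing X.2 D) - pairing X.2 (commutator Y.1 D))
    + D (pairing X.2 Y.1).
Proof.
move=> [X1 X2] [Y1 Y2] gD.
have [jXY XYE] := lie_derivativeP X1 Y2; have [jYX YXE] := lie_derivativeP Y1 X2.
rewrite (pairingD (jet_sectionB jXY jYX) (prolongation_section _) gD).
by rewrite (pairingB jXY jYX gD) XYE// YXE// pairing_prolongation.
Qed.

Lemma omega_appE X l : omni_section X -> omni_section l ->
  cochain1_app (omega X) l = 2^-1 *: (pairing l.2 X.1 + pairing X.2 l.1).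
Proof.
move=> [X1 X2] [l1 l2]; apply: val_inj.
rewrite /cochain1_app /mk_section; set s := 2^-1 *: _.
have -> : (fun x => omega X (omni_val l x)) = val s.
  apply: functional_extensionality_dep => x; rewrite /omega /omni_pairing.
  by rewrite -(pairingE x l2 X1) -(pairingE x X2 l1).
by rewrite insubdK//; exact: section_valP.
Qed.

Lemma omega_app_val X l x : omni_section X -> omni_section l ->
  cochain1_app (omega X) l x = omni_pairing (omni_val X x) (omni_val l x).
Proof.
move=> Xs ls; rewrite omega_appE// /omni_pairing.
have [X1 X2] := Xs; have [l1 l2] := ls.
by rewrite secZ secD (pairingE x l2 X1) (pairingE x X2 l1).
Qed.

(** Valid for all sections of the omni-Lie algebroid. Both brackets are expanded by
    [pairing_bracket], and skew-symmetry brings the commutators to a common order; what remains is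
    an identity of abelian groups. *)
Lemma coboundary_omega X l1 l2 : omni_section X -> omni_section l1 -> omni_section l2 ->
  coboundary (omega X) l1 l2 = - cochain1_app (omega (omni_bracket X l1)) l2.
Proof.
move=> Xs l1s l2s; have [X1 X2] := Xs; have [a1 a2] := l1s; have [b1 b2] := l2s.
have E1 := etrans (omega_appE Xs (omni_bracket_section l1s l2s))
  (congr1 (fun p => 2^-1 *: (p + pairing X.2 (commutator l1.1 l2.1)))
    (pairing_bracket l1s l2s X1)).
have E2 := etrans (omega_appE (omni_bracket_section Xs l1s) l2s)
  (congr1 (fun p => 2^-1 *: (pairing l2.2 (commutator X.1 l1.1) + p))
    (pairing_bracket Xs l1s b1)).
rewrite /coboundary E1 E2 (omega_appE Xs l1s) (omega_appE Xs l2s).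
rewrite (linear_propZ _ _ a1.1) (linear_propZ _ _ b1.1).
rewrite (linear_propD _ _ a1.1) (linear_propD _ _ b1.1) -!scalerBr -scalerN.
rewrite (pairing_commutator b2 X1 a1) (pairing_commutator a2 X1 b1).
congr (_ *: _).
(* The letters [a], [b] are derivatives of pairings along [l1], [c] and [e] along [l2], and [K]
   along [X]; [F], [G], [N] are pairings with commutators. *)
have identity (V : zmodType) (a b c e F G K N : V) :
    a + b - (c + e) - (a - F - (c - G) + K + N) =
    - (- F + (K - - G - (b - N) + e)).
  apply/eqP; rewrite -subr_eq0 !(opprD, opprK) !addrA.
  rewrite (ACl ((1*5)*(2*14)*(3*7)*(4*16)*(6*11)*(8*13)*(9*12)*(10*15)))/=.
  by rewrite !(subrr, addNr, addr0).
exact: identity.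
Qed.

(** The vector is a combination of a local frame at [x]; multiplying its constant coefficients by a
    cutoff gives a global section with the same value at [x]. *)
Lemma subbundle_section_through (L : forall x, set (omni_space E x)) x
    (e : omni_space E x) : subbundle L -> L x e ->
  exists2 l, subbundle_section L l & omni_val l x = e.
Proof.
move=> [_ [k fr]] Le; have [U [s [Uo Ux ss sL]]] := fr x.
have [W [chi [Wo Wx WU chi1 [K [Kc KU chi0]]]]] := cutoff_exists Uo Ux.
move: Le; rewrite (sL x Ux).2 => -[c _ <-].
pose g j := mul_fun (cst_fun (c j)) chi.
(* The sum runs over an arbitrary list so that its regularity can be proved by induction. *)
pose lr r : omni E := (fun u => \sum_(j <- r) scale_fun (g j) ((s j).1 u),
  (fun y => \sum_(j <- r) g j y *: (s j).2 y) : dprod (jet_space E)).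
have lrs r : omni_section (lr r).
  split; elim: r => [|j r IH].
  - suff -> : (lr [::]).1 = fun=> 0 by exact: zero_gauge.
    by apply/funext => u; exact: big_nil.
  - suff -> : (lr (j :: r)).1 = fun u => scale_fun (g j) ((s j).1 u) + (lr r).1 u.
      exact: gauge_section_lin (ss j).1 IH.
    by apply/funext => u; exact: big_cons.
  - suff -> : (lr [::]).2 = prolongation (0 : Gamma E) by exact: prolongation_section.
    apply: functional_extensionality_dep => y; apply: (etrans (big_nil _ _ _ _)).
    have := linear_prop_sum [::] (fun u : Gamma E => u) (@jet_linear _ _ E y).
    by rewrite !big_nil => <-.
  - suff -> : (lr (j :: r)).2 = (fun y => g j y *: (s j).2 y + (lr r).2 y).
      exact: jet_section_lin (ss j).2 IH.
    by apply: functional_extensionality_dep => y; exact: big_cons.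
have valE y : omni_val (lr (index_enum 'I_k)) y = \sum_j g j y *: omni_val (s j) y.
  elim: (index_enum _) => [|j r IH].
    rewrite big_nil; apply: injective_projections; last exact: big_nil.
    by apply/funext => u; rewrite /omni_val /gauge_val /= big_nil.
  rewrite big_cons -IH; apply: injective_projections; last exact: big_cons.
  by apply/funext => u; rewrite /omni_val /gauge_val /= big_cons.
exists (lr (index_enum 'I_k)); last first.
  have gx j : g j x = c j by rewrite /g mul_funE chi1// mulr1.
  rewrite valE; apply: eq_bigr => j _; exact: (congr1 (fun p => p *: _) (gx j)).
split=> [//|y]; rewrite valE; case: (pselect (U y)) => Uy.
  by rewrite (sL y Uy).2; exists (fun j => g j y).
(* Off [U] the section vanishes, and a frame around [y] exhibits 0 as an element of [L y]. *)
have [U' [s' [_ U'y _ sL']]] := fr y; rewrite (sL' y U'y).2.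
exists (fun=> 0) => //; rewrite big1 => [|j _]; last by rewrite scale0r.
have gy j : g j y = 0 by rewrite /g mul_funE chi0 ?mulr0// => /KU.
apply: esym; apply: big1 => j _.
exact: (etrans (congr1 (fun p => p *: _) (gy j)) (scale0r _)).
Qed.

End OmniLie.

Theorem proposition6p1 (R : realType) (M : manifold R) (E : vbundle M)
    (rank_gt0 : (0 < rank E)%N)
    (L : forall x : M, set (omni_space E x)) (dirac_L : dirac_structure L)
    (X : omni E) (X_section : omni_section X) :
  normalizer L X <-> cochain2_eq0 L (coboundary (omega X)).
Proof.
have [subL orthL _] := dirac_L; split=> [[_ XL] l1 l2 l1L l2L|dX].
  have [l1s _] := l1L; have [l2s l2v] := l2L; have [Ys Yv] := XL l1 l1L.
  rewrite coboundary_omega//; apply/eqP; rewrite oppr_eq0; apply/eqP.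
  apply: GammaP => x; rewrite omega_app_val//.
  by have := Yv x; rewrite orthL => -[_]; apply; exact: l2v.
split=> // l1 l1L; have [l1s _] := l1L.
have Ys := omni_bracket_section X_section l1s.
split=> // x; rewrite orthL; split; first exact: omni_val_at.
(* The cocycle condition tests sections of [L] only, whereas orthogonality concerns all vectors of
   the fiber; each of these is the value of a section. *)
move=> s /(subbundle_section_through subL)[l2 l2L <-]; have [l2s _] := l2L.
rewrite -omega_app_val//; have := dX l1 l2 l1L l2L.
by rewrite coboundary_omega// => /eqP; rewrite oppr_eq0 => /eqP ->.
Qed.
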